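(* (1) For every $k\ge1$ and $\vec s=(s_1,\dots,s_k)\in\mathbb{Z}_{\ge0}^k$, the function $\varepsilon\mapsto Li_{\vec s}(e^{\varepsilon})$ on $(-\infty,0)$ lies in $C^{Log}_S(-\infty,0)$. (2) The linear map $\mathfrak{L}:\mathcal{H}_{\ge0,+}\to C^{Log}_S(-\infty,0)$, $[\vec s]\mapsto Li_{\vec s}(e^{\varepsilon})$, is a homomorphism of nonunitary Rota–Baxter algebras from $(\mathcal{H}_{\ge0,+},\sqcup,I)$ to $(C^{Log}_S(-\infty,0),\cdot,J)$. (3) For every basis element $[\vec s]$ of $\mathcal{H}_{\ge0,+}$, $Li_{\vec s}(e^{\varepsilon})=\phi([\vec s])(\varepsilon)$.
   Context: For $\vec s=(s_1,\dots,s_k)\in\mathbb{Z}^k$ and $|z|<1$, $Li_{\vec s}(z)=\sum_{n_1>\cdots>n_k\ge1}\frac{z^{n_1}}{n_1^{s_1}\cdots n_k^{s_k}}$. $\mathcal{H}_{\ge n,+}$ ($n=0,1$) is the $\mathbb{Q}$-vector space with basis the symbols $[s_1,\dots,s_k]$, $k\ge1$, $s_i\in\mathbb{Z}_{\ge n}$; $I([s_1,s_2,\dots,s_k])=[s_1+1,s_2,\dots,s_k]$. On $\mathcal{H}_{\ge1,+}$, $[\vec s]\sqcup[\vec t]=\eta(\eta^{-1}[\vec s]\sqcup\!\sqcup\eta^{-1}[\vec t])$ where $\eta(x_0^{s_1-1}x_1\cdots x_0^{s_k-1}x_1)=[s_1,\dots,s_k]$ and $\sqcup\!\sqcup$ is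 the shuffle product of words in $x_0,x_1$ ($1\sqcup\!\sqcup w=w\sqcup\!\sqcup1=w$, $(au)\sqcup\!\sqcup(bv)=a(u\sqcup\!\sqcup bv)+b(au\sqcup\!\sqcup v)$); the product $\sqcup$ on $\mathcal{H}_{\ge0,+}$ is the unique commutative associative extension with $[0]\sqcup[\vec s]=[0,\vec s]$ for all basis elements and with $I$ a weight-$0$ Rota–Baxter operator ($P(a)P(b)=P(aP(b))+P(P(a)b)$). $C^{Log}_S(-\infty,0)$ is the set of complex-valued continuous functions $f$ on $(-\infty,0)$ that on some interval $(-\delta,0)$ coincide with a polynomial in $\ln(-\varepsilon)$ (real logarithm branch) whose coefficients are convergent Laurent series in $\varepsilon$, and satisfy $\lim_{\varepsilon\to-\infty}\varepsilon^nf(\varepsilon)=0$ for all $n\in\mathbb{N}$; it is an algebra under pointwise multiplication, and $J(f)(\varepsilon)=\int_{-\infty}^{\varepsilon}f(t)\,dt$ is a weight-$0$ Rota–Baxter operator on it. $\phi:\mathcal{H}_{\ge0,+}\to C^{Log}_S(-\infty,0)$ is the unique homomorphism of nonunitary Rota–Baxter algebras (algebra maps commuting with $I$ and $J$) with $\phi([0])=\frac{e^{\varepsilon}}{1-e^{\varepsilon}}$. *)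

(* Defs.v *)
From HB Require Import structures.
From mathcomp Require Import all_boot all_order all_algebra zify.
From mathcomp Require Import complex finmap.
From mathcomp Require Import all_classical all_reals all_analysis.
(* The notations of monalg conflict with those of mathcomp-analysis. *)
From mathcomp Require Import -(notations) monalg.

Set Implicit Arguments.
Unset Strict Implicit.
Unset Printing Implicit Defensive.

Import Order.TTheory GRing.Theory Num.Theory.
Import numFieldNormedType.Exports.

Local Open Scope ring_scope.
Local Open Scope complex_scope.
Local Open Scope classical_set_scope.

(* Free rational vector spaces: [malg K rat] is the rational vector space with
   basis [K], and [bas k] is the basis vector [k]. *)
Definition bas (K : choiceType) (k : K) : malg K rat := mkmalgU k 1.

Definition linext (K : choiceType) (V : lmodType rat) (f : K -> V)
  (a : malg K rat) : V := \sum_(k <- msupp a) mcoeff k a *: f k.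

(* The letters x_0, x_1 are [false], [true]. *)
Definition word := seq bool.

Definition lcons (b : bool) : malg word rat -> malg word rat :=
  linext (fun w : word => bas (b :: w)).

Fixpoint wshuffle (u : word) : word -> malg word rat :=
  match u with
  | [::] => fun v => bas v
  | a :: u' =>
    (fix wshuffle_u v :=
       match v with
       | [::] => bas u
       | b :: v' => lcons a (wshuffle u' v) + lcons b (wshuffle_u v')
       end)
  end.

(* [(s1, s)] stands for the symbol [s1, s_2, ..., s_k] with tail [s]. *)
Definition symb : Type := (nat * seq nat)%type.
HB.instance Definition _ := Choice.on symb.

Definition seq_of_symb (s : symb) : seq nat := s.1 :: s.2.

Definition symb_of_seq (s : seq nat) : symb := (head 0%N s, behead s).

(* H_{>=0,+}. Its subspace H_{>=1,+} is spanned by the [bas s] with [positive s]. *)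
Notation Hge0 := (malg symb rat).

Definition positive (s : symb) : bool := all (leq 1) (seq_of_symb s).

Definition Iop : Hge0 -> Hge0 := linext (fun s : symb => bas ((s.1.+1, s.2) : symb)).

(* eta^{-1} on basis elements: x_0^(s_1 - 1) x_1 ... x_0^(s_k - 1) x_1. *)
Definition word_of_symb (s : symb) : word :=
  flatten [seq rcons (nseq i.-1 false) true | i <- seq_of_symb s].

(* Decoding of x_0^(m_1) x_1 ... x_0^(m_k) x_1 as (c + m_1, 1 + m_2, ...);
   only meaningful on nonempty words ending in x_1. *)
Fixpoint exponents (c : nat) (w : word) : seq nat :=
  match w with
  | [::] => [::]
  | false :: w' => exponents c.+1 w'
  | true :: w' => c :: exponents 1 w'
  end.

Definition eta : malg word rat -> Hge0 :=
  linext (fun w : word => bas (symb_of_seq (exponents 1 w))).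

Definition shuffle1 (s t : symb) : Hge0 :=
  eta (wshuffle (word_of_symb s) (word_of_symb t)).

Record is_shuffle_extension (sh : Hge0 -> Hge0 -> Hge0) : Prop := {
  sh_linl : forall b, linear (sh^~ b);
  sh_linr : forall a, linear (sh a);
  sh_comm : commutative sh;
  sh_assoc : associative sh;
  sh_extends : forall s t : symb, positive s -> positive t ->
    sh (bas s) (bas t) = shuffle1 s t;
  sh_zero : forall s : symb,
    sh (bas ((0%N, [::]) : symb)) (bas s) = bas ((0%N, seq_of_symb s) : symb);
  sh_RB : forall a b : Hge0,
    sh (Iop a) (Iop b) = Iop (sh a (Iop b)) + Iop (sh (Iop a) b)
}.

Section LinearExtension.
Variables (K : choiceType) (V : lmodType rat).
Implicit Types (f : K -> V) (a b : malg K rat).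

Lemma linextEw f a (d : {fset K}) : fsubset (msupp a) d ->
  linext f a = \sum_(k <- d) mcoeff k a *: f k.
Proof.
move=> le; rewrite [LHS](big_fset_incl _ le) => //= x xd /mcoeff_outdom ->.
by rewrite scale0r.
Qed.

Lemma linext_bas f k : linext f (bas k) = f k.
Proof. by rewrite (linextEw _ msuppU_le) big_seq_fset1 mcoeffUU scale1r. Qed.

Lemma linext_is_linear f : linear (linext f).
Proof.
move=> q a b; pose d := (msupp a `|` msupp b)%fset.
rewrite !(@linextEw f _ d) ?fsubsetUl ?fsubsetUr //; last first.
  apply: fsubset_trans (msuppD_le _ _) _; rewrite /d.
  by apply: fsetSU; apply: msuppZ_le.
rewrite scaler_sumr -big_split; apply: eq_bigr => k _ /=.
by rewrite mcoeffD mcoeffZ scalerDl scalerA.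
Qed.
HB.instance Definition _ f :=
  GRing.isLinear.Build rat (malg K rat) V *:%R (linext f) (linext_is_linear f).

Lemma malg_ind (P : malg K rat -> Prop) : P 0 ->
  (forall q a b, P a -> P b -> P (q *: a + b)) ->
  (forall k, P (bas k)) -> forall a, P a.
Proof.
move=> P0 PD Pk a; rewrite (monalgE a).
elim/big_ind: _ => // [x y Px Py|k _].
  by rewrite -[x]scale1r; apply: PD.
have -> : mkmalgU k (mcoeff k a) = mcoeff k a *: bas k + 0.
  rewrite addr0; apply/malgP => k'; rewrite mcoeffZ !mcoeffU.
  by case: (k == k'); rewrite ?mulr1n ?mulr0n ?mulr1 ?mulr0.
exact: PD.
Qed.
End LinearExtension.

Lemma exponents_word_of_symb c i s : positive (i, s) ->
  exponents c (word_of_symb (i, s)) = (c + i.-1)%N :: s.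
Proof.
have expE n : forall d w,
    exponents d (rcons (nseq n false) true ++ w) = (d + n)%N :: exponents 1 w.
  by elim: n => [|n IHn] d w /=; rewrite ?addn0 // IHn addSnnS.
elim: s i c => [|j s IH] i c.
  by move=> _; rewrite /word_of_symb /= -[rcons _ _]cats0 -catA expE.
move=> /andP[_ ps]; have /andP[j0 _] := ps.
by rewrite -[word_of_symb _]/(_ ++ word_of_symb (j, s)) expE IH // add1n prednK.
Qed.

Lemma eta_word_of_symb s : positive s -> eta (bas (word_of_symb s)) = bas s.
Proof.
case: s => i s ps; rewrite /eta linext_bas exponents_word_of_symb //.
by rewrite add1n prednK //; case/andP: ps.
Qed.

Module ShuffleExistence.
Section Existence.

Let A := malg word rat.
Let P := lcons false.
Let D := lcons true.

Lemma lcons_lin b : linear (lcons b).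
Proof. exact: linearP. Qed.
HB.instance Definition _ b :=
  GRing.isLinear.Build rat A A *:%R (lcons b) (lcons_lin b).

Lemma lcons_bas b w : lcons b (bas w) = bas (b :: w).
Proof. exact: linext_bas. Qed.

Lemma Iop_lin : linear Iop.
Proof. exact: linearP. Qed.
HB.instance Definition _ := GRing.isLinear.Build rat Hge0 Hge0 *:%R Iop Iop_lin.

Fixpoint sh0 (u : word) : word -> A :=
  match u with
  | [::] => fun v => bas v
  | true :: u' => fun v => lcons true (sh0 u' v)
  | false :: u' =>
    (fix sh0_u v :=
       match v with
       | [::] => bas u
       | true :: v' => lcons true (sh0_u v')
       | false :: v' => lcons false (sh0 u' v) + lcons false (sh0_u v')
       end)
  end.

Lemma sh0_nil u : sh0 u [::] = bas u.
Proof. by elim: u => [|[] u IH] //=; rewrite IH lcons_bas. Qed.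

Lemma sh0_D u v : sh0 u (true :: v) = lcons true (sh0 u v).
Proof. by elim: u => [|[] u IH] //=; rewrite ?lcons_bas ?IH. Qed.

Lemma sh0_Dl u v : sh0 (true :: u) v = lcons true (sh0 u v).
Proof. by []. Qed.

Lemma sh0_I u v : sh0 (false :: u) (false :: v) =
  lcons false (sh0 u (false :: v)) + lcons false (sh0 (false :: u) v).
Proof. by []. Qed.

Lemma sh0_C u v : sh0 u v = sh0 v u.
Proof.
elim: u v => [|a u IHu] v; first by rewrite sh0_nil.
elim: v => [|b v IHv]; first by rewrite sh0_nil.
case: a IHv => IHv; first by rewrite sh0_D /= IHu.
case: b; first by rewrite sh0_D sh0_Dl IHv.
by rewrite !sh0_I IHv IHu addrC.
Qed.

Definition M : A -> A -> A :=
  locked (fun a b => linext (fun u => linext (sh0 u) b) a).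

Lemma ME a b : M a b = linext (fun u => linext (sh0 u) b) a.
Proof. by rewrite /M -lock. Qed.

Lemma M_DZl q x y b : M (q *: x + y) b = q *: M x b + M y b.
Proof. by rewrite !ME linext_is_linear. Qed.

Lemma M_linr a : linear (M a).
Proof.
move=> q x y; rewrite !ME /linext scaler_sumr -big_split.
apply: eq_bigr => u _ /=; rewrite -!/(linext (sh0 u) _) linext_is_linear.
by rewrite scalerDr !scalerA mulrC.
Qed.

HB.instance Definition _ a := GRing.isLinear.Build rat A A *:%R (M a) (M_linr a).

Lemma M_DZr a q x y : M a (q *: x + y) = q *: M a x + M a y.
Proof. exact: M_linr. Qed.

Lemma M_0l b : M 0 b = 0. Proof. by rewrite ME linear0. Qed.
Lemma M_0r a : M a 0 = 0. Proof. exact: linear0. Qed.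

Lemma lcons_DZ b q x y : lcons b (q *: x + y) = q *: lcons b x + lcons b y.
Proof. exact: lcons_lin. Qed.

Lemma lcons_0 b : lcons b 0 = 0. Proof. exact: linear0. Qed.

Lemma lcons_D b x y : lcons b (x + y) = lcons b x + lcons b y.
Proof. exact: linearD. Qed.

Lemma M_bas u v : M (bas u) (bas v) = sh0 u v.
Proof. by rewrite ME !linext_bas. Qed.

Lemma M_C a b : M a b = M b a.
Proof.
elim/malg_ind: a => [|q x y IHx IHy|u]; first by rewrite M_0l M_0r.
  by rewrite M_DZl M_DZr IHx IHy.
elim/malg_ind: b => [|q x y IHx IHy|v]; first by rewrite M_0l M_0r.
  by rewrite M_DZl M_DZr IHx IHy.
by rewrite !M_bas sh0_C.
Qed.

Lemma M_nil b : M (bas [::]) b = b.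
Proof.
elim/malg_ind: b => [|q x y IHx IHy|v]; first by rewrite M_0r.
  by rewrite M_DZr IHx IHy.
by rewrite M_bas.
Qed.

Lemma M_Dl a b : M (D a) b = D (M a b).
Proof.
elim/malg_ind: a => [|q x y IHx IHy|u]; first by rewrite /D !(lcons_0, M_0l).
  by rewrite /D lcons_DZ !M_DZl lcons_DZ -/D IHx IHy.
elim/malg_ind: b => [|q x y IHx IHy|v]; first by rewrite /D !(lcons_0, M_0r).
  by rewrite !M_DZr /D lcons_DZ -/D IHx IHy.
by rewrite /D lcons_bas !M_bas.
Qed.

Lemma M_Dr a b : M a (D b) = D (M a b).
Proof. by rewrite M_C M_Dl M_C. Qed.

Lemma M_P a b : M (P a) (P b) = P (M a (P b)) + P (M (P a) b).
Proof.
rewrite /P; elim/malg_ind: a => [|q x y IHx IHy|u].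
- by rewrite lcons_0 !M_0l lcons_0 addr0.
- rewrite !lcons_DZ !M_DZl !lcons_DZ IHx IHy scalerDr -!addrA; congr (_ + _).
  by rewrite addrCA.
elim/malg_ind: b => [|q x y IHx IHy|v]; first by rewrite lcons_0 !M_0r lcons_0 addr0.
  rewrite !lcons_DZ !M_DZr !lcons_DZ IHx IHy scalerDr -!addrA; congr (_ + _).
  by rewrite addrCA.
by rewrite !lcons_bas !M_bas.
Qed.

Lemma M_Dadd a b c : M (a + b) c = M a c + M b c.
Proof. by rewrite -[a]scale1r M_DZl !scale1r. Qed.

Lemma M_addr a b c : M a (b + c) = M a b + M a c.
Proof. exact: linearD. Qed.

Lemma M_A_bas u v w :
  M (bas u) (M (bas v) (bas w)) = M (M (bas u) (bas v)) (bas w).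
Proof.
have [n] := ubnP (size u + size v + size w)%N.
elim: n u v w => // n IH [|a u] v w; first by rewrite !M_nil.
case: v => [|b v]; first by rewrite [M _ (bas [::])]M_C !M_nil.
case: w => [|c w]; first by rewrite ![M _ (bas [::])]M_C !M_nil.
rewrite /= ltnS => le.
case: a le => le.
  by rewrite -lcons_bas -/D !M_Dl IH //=; lia.
case: b le => le.
  by rewrite -[bas (true :: v)]lcons_bas -/D !(M_Dl, M_Dr) IH //=; lia.
case: c le => le.
  by rewrite -[bas (true :: w)]lcons_bas -/D !M_Dr IH //=; lia.
have E1 := IH u (false :: v) (false :: w) ltac:(rewrite /=; lia).
have E2 := IH (false :: u) v (false :: w) ltac:(rewrite /=; lia).
have E3 := IH (false :: u) (false :: v) w ltac:(rewrite /=; lia).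
rewrite -!lcons_bas -!/(P _) in E1 E2 E3 *.
have PD x y : P x + P y = P (x + y) by rewrite /P lcons_D.
have MP x y : M (P x) (P y) = P (M x (P y) + M (P x) y) by rewrite M_P PD.
have -> : M (P (bas u)) (M (P (bas v)) (P (bas w))) =
    P (M (bas u) (M (P (bas v)) (P (bas w))) +
       M (P (bas u)) (M (bas v) (P (bas w)) + M (P (bas v)) (bas w))).
  by rewrite [M (P (bas v)) (P (bas w))]MP [LHS]MP.
rewrite M_addr E1 E2 E3.
have -> : M (M (P (bas u)) (P (bas v))) (P (bas w)) =
    P (M (M (bas u) (P (bas v)) + M (P (bas u)) (bas v)) (P (bas w)) +
       M (M (P (bas u)) (P (bas v))) (bas w)).
  by rewrite [M (P (bas u)) (P (bas v))]MP [LHS]MP.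
by rewrite M_Dadd addrA.
Qed.

Lemma M_A : associative M.
Proof.
move=> a b c.
elim/malg_ind: a => [|q x y IHx IHy|u]; first by rewrite !M_0l.
  by rewrite !M_DZl IHx IHy.
elim/malg_ind: b => [|q x y IHx IHy|v]; first by rewrite !(M_0l, M_0r).
  by rewrite !(M_DZl, M_DZr) IHx IHy.
elim/malg_ind: c => [|q x y IHx IHy|w]; first by rewrite !M_0r.
  by rewrite !M_DZr IHx IHy.
exact: M_A_bas.
Qed.

(* [s_1, ..., s_k] is encoded as the word P^s_1 D ... P^s_k D, where D prepends
   a zero: the product on H_{>=0,+} then satisfies the recursion of [sh0]. *)
Definition enc (s : symb) : word :=
  flatten [seq rcons (nseq i false) true | i <- seq_of_symb s].
Definition encl : Hge0 -> A := linext (fun s => bas (enc s)).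
Fixpoint dec (c : nat) (w : word) : seq nat :=
  match w with
  | [::] => [::]
  | false :: w' => dec c.+1 w'
  | true :: w' => c :: dec 0 w'
  end.
Definition decl : A -> Hge0 := linext (fun w : word => bas (symb_of_seq (dec 0 w))).

Lemma encl_DZ q x y : encl (q *: x + y) = q *: encl x + encl y.
Proof. exact: linext_is_linear. Qed.
Lemma decl_DZ q x y : decl (q *: x + y) = q *: decl x + decl y.
Proof. exact: linext_is_linear. Qed.
Lemma Iop_DZ q x y : Iop (q *: x + y) = q *: Iop x + Iop y.
Proof. exact: linext_is_linear. Qed.
Lemma encl_0 : encl 0 = 0. Proof. exact: linear0. Qed.
Lemma decl_0 : decl 0 = 0. Proof. exact: linear0. Qed.
Lemma Iop_0 : Iop 0 = 0. Proof. exact: linear0. Qed.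
Lemma encl_D x y : encl (x + y) = encl x + encl y.
Proof. exact: linearD. Qed.
Lemma decl_D x y : decl (x + y) = decl x + decl y.
Proof. exact: linearD. Qed.

Lemma enc_dec s : dec 0 (enc s) = seq_of_symb s.
Proof.
case: s => i s; rewrite /enc /seq_of_symb /=.
have decE n w : forall d, dec d (rcons (nseq n false) true ++ w) = (d + n)%N :: dec 0 w.
  by elim: n => [|n IHn] d /=; rewrite ?addn0 // IHn addSnnS.
elim: s i => [|j s IH] i; rewrite /= ?cats0.
  by rewrite -[rcons _ _]cats0 decE.
by rewrite decE IH.
Qed.

Lemma enclK a : decl (encl a) = a.
Proof.
elim/malg_ind: a => [|q x y IHx IHy|s]; first by rewrite encl_0 decl_0.
  by rewrite encl_DZ decl_DZ IHx IHy.
by rewrite /encl /decl !linext_bas enc_dec; case: s.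
Qed.

Definition good x := exists a, x = encl a.

Lemma goodK x : good x -> encl (decl x) = x.
Proof. by case=> a ->; rewrite enclK. Qed.

Lemma good_encl a : good (encl a). Proof. by exists a. Qed.

Lemma good_DZ q x y : good x -> good y -> good (q *: x + y).
Proof. by case=> a -> [b ->]; exists (q *: a + b); rewrite encl_DZ. Qed.

Lemma good_D x y : good x -> good y -> good (x + y).
Proof. by rewrite -{2}[x]scale1r; exact: good_DZ. Qed.

Lemma encl_Iop a : encl (Iop a) = P (encl a).
Proof.
elim/malg_ind: a => [|q x y IHx IHy|s]; first by rewrite Iop_0 encl_0 /P lcons_0.
  by rewrite Iop_DZ !encl_DZ IHx IHy /P lcons_DZ.
by rewrite /Iop /encl /P !linext_bas lcons_bas.
Qed.

Lemma good_P x : good x -> good (P x).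
Proof. by case=> a ->; exists (Iop a); rewrite encl_Iop. Qed.

Lemma good_D1 x : good x -> good (D x).
Proof.
case=> a ->; exists (linext (fun s => bas ((0%N, seq_of_symb s) : symb)) a).
elim/malg_ind: a => [|q x' y IHx IHy|s]; first by rewrite linear0 encl_0 /D lcons_0.
  by rewrite linext_is_linear !encl_DZ -IHx -IHy /D lcons_DZ.
by rewrite /encl /D !linext_bas lcons_bas.
Qed.

Lemma good_bas u : u != [::] -> last true u -> good (bas u).
Proof.
elim: u => // b u IH _; case: u IH => [|c u] IH.
  by case: b => // _; exists (bas ((0%N, [::]) : symb)); rewrite /encl linext_bas.
by move=> /= /IH gu; rewrite -lcons_bas; case: b; [apply: good_D1|apply: good_P]; apply: gu.
Qed.

Lemma good_sh0 u v : u ++ v != [::] -> last true u -> last true v -> good (sh0 u v).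
Proof.
have lastS b w : last true (b :: w) -> last true w by case: w.
have [n] := ubnP (size u + size v)%N.
elim: n u v => // n IH [|a u] v le; first by move=> v0 _; exact: good_bas.
case: v le => [|b v] le.
  by rewrite sh0_nil cats0 => ? ? _; exact: good_bas.
move=> _ lu lv; have lu' := lastS _ _ lu; have lv' := lastS _ _ lv.
have uv : u ++ b :: v != [::] by case: (u).
have g1 : good (sh0 u (b :: v)) by apply: IH => //=; move: le => /=; lia.
have g2 : good (sh0 (a :: u) v) by apply: IH => //=; move: le => /=; lia.
case: a {lu le} g2 => g2; first by rewrite sh0_Dl; apply: good_D1.
case: b lv {uv} g1 => lv g1; first by rewrite sh0_D; apply: good_D1.
by rewrite sh0_I; apply: good_D; apply: good_P.
Qed.

Lemma last_enc s : last true (enc s).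
Proof.
rewrite /enc; elim: (seq_of_symb s) => //= i t IH.
by rewrite last_cat last_rcons.
Qed.

Lemma enc_neq0 s : enc s != [::].
Proof. by case: s => -[|i] s. Qed.

Lemma good_M a b : good (M (encl a) (encl b)).
Proof.
elim/malg_ind: a => [|q x y IHx IHy|s].
- by exists 0; rewrite !encl_0 M_0l.
- by rewrite encl_DZ M_DZl; apply: good_DZ.
elim/malg_ind: b => [|q x y IHx IHy|t].
- by exists 0; rewrite !encl_0 M_0r.
- by rewrite encl_DZ M_DZr; apply: good_DZ.
rewrite /encl !linext_bas M_bas; apply: good_sh0; rewrite ?last_enc //.
by case: (enc s) (enc_neq0 s).
Qed.

Definition shuffle0 : Hge0 -> Hge0 -> Hge0 :=
  locked (fun a b => decl (M (encl a) (encl b))).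

Lemma shuffle0E a b : shuffle0 a b = decl (M (encl a) (encl b)).
Proof. by rewrite /shuffle0 -lock. Qed.

Lemma encl_shuffle0 a b : encl (shuffle0 a b) = M (encl a) (encl b).
Proof. by rewrite shuffle0E; apply/goodK/good_M. Qed.

Lemma encl_inj : injective encl.
Proof. exact: can_inj enclK. Qed.

Definition sub1 (w : word) : word :=
  flatten [seq if b then [:: false; true] else [:: false] | b <- w].

Lemma dec_sub1 c w : dec c (sub1 w) = exponents c.+1 w.
Proof. by elim: w c => [|[] w IH] c //=; rewrite IH. Qed.

Lemma sub1_word s : positive s -> sub1 (word_of_symb s) = enc s.
Proof.
rewrite /sub1 /word_of_symb /enc /positive; elim: (seq_of_symb s) => //= i t IH.
case/andP => i0 pt; rewrite map_cat flatten_cat IH //; congr (_ ++ _).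
by case: i i0 => // i _ /=; elim: i => //= i ->.
Qed.

Definition sub1l : A -> A := linext (fun w => bas (sub1 w)).

Lemma sub1l_D x y : sub1l (x + y) = sub1l x + sub1l y.
Proof. exact: linearD. Qed.

Lemma sub1l_cons b x : sub1l (lcons b x) = P (if b then D (sub1l x) else sub1l x).
Proof.
elim/malg_ind: x => [|q x y IHx IHy|w].
- by rewrite lcons_0 /sub1l linear0 /P /D; case: b; rewrite !lcons_0.
- rewrite lcons_DZ /sub1l !linext_is_linear -/sub1l IHx IHy /P /D.
  by case: b {IHx IHy}; rewrite !lcons_DZ.
rewrite lcons_bas /sub1l /P /D !linext_bas.
by case: b; rewrite !lcons_bas.
Qed.

Lemma wshuffle_nil u : wshuffle u [::] = bas u.
Proof. by case: u. Qed.

Lemma wshuffle_cons a u b v : wshuffle (a :: u) (b :: v) =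
  lcons a (wshuffle u (b :: v)) + lcons b (wshuffle (a :: u) v).
Proof. by []. Qed.

Lemma sub1_bas_cons b w :
  bas (sub1 (b :: w)) = P (if b then D (bas (sub1 w)) else bas (sub1 w)).
Proof. by case: b; rewrite /P /D !lcons_bas. Qed.

Lemma sub1_shuffle u v : sub1l (wshuffle u v) = M (bas (sub1 u)) (bas (sub1 v)).
Proof.
elim: u v => [|a u IHu] v; first by rewrite M_nil /= /sub1l linext_bas.
elim: v => [|b v IHv]; first by rewrite wshuffle_nil M_C M_nil /sub1l linext_bas.
rewrite wshuffle_cons sub1l_D !sub1l_cons IHu IHv !sub1_bas_cons.
rewrite [RHS]M_P; apply: (f_equal2 +%R); apply: (f_equal P).
  by case: a {IHv} => //; rewrite M_Dl.
by case: b {IHv} => //; rewrite M_Dr.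
Qed.

Lemma eta_sub1 x : eta x = decl (sub1l x).
Proof.
elim/malg_ind: x => [|q x y IHx IHy|w].
- by rewrite /eta /sub1l !linear0 decl_0.
- by rewrite [LHS]linext_is_linear [sub1l _]linext_is_linear decl_DZ -IHx -IHy.
by rewrite /eta /sub1l /decl !linext_bas dec_sub1.
Qed.

Lemma shuffle0P : is_shuffle_extension shuffle0.
Proof.
split.
- by move=> b q x y; rewrite !shuffle0E encl_DZ M_DZl decl_DZ.
- by move=> a q x y; rewrite !shuffle0E encl_DZ M_DZr decl_DZ.
- by move=> a b; rewrite !shuffle0E M_C.
- move=> a b c; apply: encl_inj; rewrite (encl_shuffle0 a) (encl_shuffle0 b c).
  by rewrite (encl_shuffle0 _ c) (encl_shuffle0 a b) M_A.
- move=> s t ps pt; rewrite /shuffle1 eta_sub1 sub1_shuffle !sub1_word //.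
  by rewrite shuffle0E /encl !linext_bas.
- move=> s; apply: encl_inj; rewrite encl_shuffle0 /encl !linext_bas.
  by rewrite M_bas; exact: lcons_bas.
- move=> a b; apply: encl_inj.
  by rewrite encl_D encl_shuffle0 !encl_Iop M_P !encl_shuffle0 !encl_Iop.
Qed.

End Existence.
End ShuffleExistence.

Lemma shuffle_extension_uniq sh sh' :
  is_shuffle_extension sh -> is_shuffle_extension sh' -> sh = sh'.
Proof.
move=> [linl linr C As _ z rb] [linl' linr' C' As' _ z' rb'].
have l0 (f : Hge0 -> Hge0) : linear f -> f 0 = 0.
  by move=> lf; have := lf (-1) 0 0; rewrite scaler0 addr0 scaleN1r addNr.
have ext (f g : Hge0 -> Hge0) : linear f -> linear g -> (forall s, f (bas s) = g (bas s)) -> f = g.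
  move=> lf lg fg; apply: funext => a.
  elim/malg_ind: a => [|q x y IHx IHy|s] //; first by rewrite (l0 f) ?(l0 g).
  by rewrite lf lg IHx IHy.
suff E s t : sh (bas s) (bas t) = sh' (bas s) (bas t).
  apply: funext => a; apply: (ext) => // t.
  have /(congr1 (fun f => f a)) // : sh^~ (bas t) = sh'^~ (bas t).
  by apply: (ext) => // s; apply: E.
pose m (s : symb) := (sumn (seq_of_symb s) + size s.2)%N.
have [n] := ubnP (m s + m t)%N.
elim: n s t => // n IH s t lt.
have E0 : sh (bas ((0%N, [::]) : symb)) = sh' (bas ((0%N, [::]) : symb)).
  by apply: (ext) => // u; rewrite z z'.
have Ez u v : (m u + m v < n)%N ->
  sh (bas ((0%N, seq_of_symb u) : symb)) (bas v) =
  sh' (bas ((0%N, seq_of_symb u) : symb)) (bas v).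
  by move=> le; rewrite -[in LHS]z -[in RHS]z' -As -As' E0 IH.
case: s lt => -[|i] s; first case: s => [|j s] lt.
- by rewrite E0.
- by apply: (Ez (j, s)); move: lt; rewrite /m /=; lia.
case: t => -[|k] t; first case: t => [|j t] lt.
- by rewrite C C' E0.
- by rewrite C C'; apply: (Ez (j, t)); move: lt; rewrite /m /=; lia.
move=> lt.
have Ib i' s' : bas ((i'.+1, s') : symb) = Iop (bas ((i', s') : symb)).
  by rewrite /Iop linext_bas.
rewrite !Ib rb rb' -!Ib !IH //; move: lt; rewrite /m /=; lia.
Qed.

Lemma shuffle_extension_exists_unique : exists! sh, is_shuffle_extension sh.
Proof.
exists ShuffleExistence.shuffle0; split; first exact: ShuffleExistence.shuffle0P.
by move=> sh; apply: shuffle_extension_uniq; exact: ShuffleExistence.shuffle0P.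
Qed.

(* [R[i]^o] is [R[i]] with the topology of the modulus. *)

(* Partial sum of Li_s(z) over N > n_1 > ... > n_k >= 1; by absolute
   convergence for |z| < 1, its limit is the sum over all n_1 > ... > n_k >= 1. *)
Definition Li_partial (R : realType) (s : seq int) (z : R[i]) (N : nat) : R[i]^o :=
  \sum_(n : (size s).-tuple 'I_N |
        sorted gtn [seq val m | m <- n] && all (leq 1) [seq val m | m <- n])
    z ^+ head 0%N [seq val m | m <- n] /
    \prod_(j < size s) ((tnth n j)%:R : R[i]) ^ s`_j.

Definition Li (R : realType) (s : seq int) (z : R[i]) : R[i] :=
  limn (Li_partial s z).

(* The Laurent series sum_{n >= 0} a_n z^(n - p). *)
Definition laurent_partial (R : realType) (p : nat) (a : nat -> R[i]) (z : R[i]) :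
  nat -> R[i]^o := series (fun n => a n * z ^ (n%:Z - p%:Z)).

Definition laurent_sum (R : realType) (p : nat) (a : nat -> R[i]) (z : R[i]) : R[i] :=
  limn (laurent_partial p a z).

Definition laurent_converges (R : realType) (delta : R) (p : nat)
    (a : nat -> R[i]) : Prop :=
  forall z : R[i], 0 < `|z| < delta%:C -> cvgn (laurent_partial p a z).

(* C^Log_S(-oo, 0). Elements are represented by functions on R whose values on
   [0, +oo) are irrelevant. *)
Record CLogS (R : realType) (f : R -> R[i]) : Prop := {
  CLogS_continuous : {within `]-oo, 0[, continuous (f : R -> R[i]^o)};
  CLogS_near0 : exists (delta : R) (d : nat) (p : nat -> nat) (a : nat -> nat -> R[i]),
    [/\ 0 < delta,
        forall j, (j < d)%N -> laurent_converges delta (p j) (a j) &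
        forall x : R, - delta < x < 0 ->
          f x = \sum_(j < d) laurent_sum (p j) (a j) x%:C * (ln (- x))%:C ^+ j];
  CLogS_decay : forall n : nat,
    (x%:C ^+ n * f x : R[i]^o) @[x --> -oo] --> (0 : R[i]^o)
}.

Definition Jop (R : realType) (f : R -> R[i]) (x : R) : R[i] :=
  (\int[lebesgue_measure]_(t in `]-oo, x]) complex.Re (f t)) +i*
  (\int[lebesgue_measure]_(t in `]-oo, x]) complex.Im (f t)).

(* Homomorphisms of nonunitary Rota-Baxter Q-algebras from (H_{>=0,+}, sh, I)
   to (C^Log_S(-oo, 0), pointwise product, J). *)
Record RB_hom (R : realType) (sh : Hge0 -> Hge0 -> Hge0)
    (phi : Hge0 -> R -> R[i]) : Prop := {
  RB_hom_CLogS : forall a : Hge0, CLogS (phi a);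
  RB_hom_linear : forall (q : rat) (a b : Hge0) (x : R), x < 0 ->
    phi (q *: a + b) x = ratr q * phi a x + phi b x;
  RB_hom_mul : forall (a b : Hge0) (x : R), x < 0 ->
    phi (sh a b) x = phi a x * phi b x;
  RB_hom_RB : forall (a : Hge0) (x : R), x < 0 ->
    phi (Iop a) x = Jop (phi a) x
}.

Definition Li_exp (R : realType) (s : seq nat) (x : R) : R[i] :=
  Li [seq n%:Z | n <- s] (expR x)%:C.

(* The linear map [s] |-> Li_s(e^x). *)
Definition frakL (R : realType) (a : Hge0) (x : R) : R[i] :=
  \sum_(s <- msupp a) ratr (mcoeff s a) * Li_exp (seq_of_symb s) x.

(* Main.v *)
Require Import Defs.
From mathcomp Require Import all_boot all_order all_algebra.
From mathcomp Require Import complex finmap.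
From mathcomp Require Import all_classical all_reals all_analysis.
From mathcomp Require Import -(notations) monalg.
From mathcomp Require Import measurable_realfun ring lra zify.

(** Write L_s(x) = Li_s(e^x) = sum_n c_s(n) e^(nx) for x < 0. The coefficients
    satisfy n c_(k+1,s)(n) = c_(k,s)(n), so L_(k+1,s)' = L_(k,s), and since L_s
    vanishes at -oo this gives L o I = J o L; moreover c_(0,k,s) is the Cauchy
    product of c_(k,s) with the coefficients of z/(1-z), so
    L_(0,k,s) = L_(0) L_(k,s). These two recursions determine L on the basis,
    hence L = phi. Multiplicativity follows by induction on the weight: with the
    Rota-Baxter identity for I, both sides have the same derivative and vanish
    at -oo. Near 0, L_(0)(x) = 1/(e^(-x) - 1) is a Laurent series, and the
    functions that are polynomials in ln(-x) with Laurent coefficients are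
    stable under products with Laurent series and under antiderivatives, so
    the same two recursions put every L_s in C^Log. *)

Set Implicit Arguments.
Unset Strict Implicit.
Unset Printing Implicit Defensive.

Import Order.TTheory GRing.Theory Num.Theory.
Import numFieldNormedType.Exports.

Local Open Scope ring_scope.
Local Open Scope complex_scope.
Local Open Scope classical_set_scope.

(** * Power series *)

Section PowerSeries.
Variable R : realType.
Implicit Types (a b : nat -> R) (r x q : R).

(* By the Cauchy-Hadamard formula this says that the radius of convergence of
   sum_n a_n x^n is at least [r]. *)
Definition rad a r :=
  forall rho, 0 < rho < r -> exists M, forall n, `|a n| * rho ^+ n <= M.

Definition PS a x : R := limn (pseries a x).

Definition conv a b (n : nat) : R := \sum_(i < n.+1) a i * b (n - i)%N.

(** Coefficients of x times the series. *)
Definition shift_coef a (n : nat) : R := if n is m.+1 then a m else 0.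

(** Since q^n <= q^i for i <= n, the left side is at most 1 + q + ... + q^n, hence at most 1 / (1 -
    q). *)
Lemma natrM_expr_bounded q : 0 <= q < 1 ->
  exists M, forall n, n.+1%:R * q ^+ n <= M.
Proof.
move=> /andP[q0 q1]; exists (1 - q)^-1 => n.
have q1' : 0 < 1 - q by rewrite subr_gt0.
rewrite -[leRHS]mul1r ler_pdivlMr//.
apply: (@le_trans _ _ ((\sum_(i < n.+1) q ^+ i) * (1 - q))).
  rewrite ler_wpM2r ?(ltW q1')// mulr_natl -[X in _ *+ X](card_ord n.+1) -sumr_const.
  apply: ler_sum => i _; apply: ler_wiXn2l => //; first exact: ltW.
  by rewrite -ltnS.
rewrite mulrC -[X in X * _]opprB mulNr -subrX1 opprB.
by rewrite lerBlDr lerDl exprn_ge0.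
Qed.

Lemma rad_le a r r' : r' <= r -> rad a r -> rad a r'.
Proof. by move=> le ar rho /andP[? lt]; apply: ar; rewrite (lt_le_trans lt) // andbT. Qed.

Lemma rad_dominated C a b r : 0 <= C ->
  (forall n, `|b n| <= C * `|a n|) -> rad a r -> rad b r.
Proof.
move=> C0 ab ar rho rr; have [M aM] := ar _ rr; exists (C * M) => n.
rewrite (le_trans (ler_wpM2r _ (ab n)))//.
  by case/andP: rr => /ltW ? _; exact: exprn_ge0.
by rewrite -mulrA ler_wpM2l.
Qed.

Lemma rad_geometric a C K : 0 < K -> (forall n, `|a n| <= C * K ^+ n) -> rad a K^-1.
Proof.
move=> K0 aK rho /andP[r0 rK]; exists C => n.
have C0 : 0 <= C by have := le_trans (normr_ge0 _) (aK 0%N); rewrite expr0 mulr1.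
apply: le_trans (ler_wpM2r _ (aK n)) _; first exact/exprn_ge0/ltW.
rewrite -mulrA -exprMn -[leRHS]mulr1 ler_wpM2l// exprn_ile1//.
  by rewrite mulr_ge0 ?ltW.
by rewrite -ler_pdivlMl// mulr1 ltW.
Qed.

Lemma rad_add a b r : rad a r -> rad b r -> rad (fun n => a n + b n) r.
Proof.
move=> ar br rho rr; have [M aM] := ar _ rr; have [N bN] := br _ rr.
exists (M + N) => n; apply: le_trans (lerD (aM n) (bN n)).
rewrite -mulrDl ler_wpM2r ?ler_normD//.
by case/andP: rr => /ltW ? _; exact: exprn_ge0.
Qed.

Lemma rad_scale k a r : rad a r -> rad (fun n => k * a n) r.
Proof. by apply: (@rad_dominated `|k|) => // n; rewrite normrM. Qed.

(** Leaves room between |x| and r: comparison at the intermediate radius gives a geometric ratio |x|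
    / rho < 1. *)
Lemma rad_mid r x : `|x| < r -> exists2 rho, 0 < rho < r & `|x| < rho.
Proof.
move=> xr; exists ((`|x| + r) / 2); last by rewrite midf_lt.
rewrite midf_lt// andbT divr_gt0// ltr_wpDl//; exact: le_lt_trans xr.
Qed.

(* The factor n + 1 is absorbed by a slightly larger radius. *)
Lemma rad_natM a r rho : 0 < rho < r -> rad a r ->
  exists M, forall n, n.+1%:R * `|a n| * rho ^+ n <= M.
Proof.
move=> /andP[r0 rr] ar.
have [|s /andP[s0 sr] rs] := @rad_mid r rho; first by rewrite gtr0_norm.
rewrite gtr0_norm// in rs.
have [|M aM] := ar s; first by rewrite s0.
have [|B qB] := @natrM_expr_bounded (rho / s).
  by rewrite divr_ge0 ?ltW// ltr_pdivrMr// mul1r.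
have q0 n : 0 <= (rho / s) ^+ n by rewrite exprn_ge0// divr_ge0 ?ltW.
have M0 : 0 <= M by apply: le_trans (aM 0%N); rewrite expr0 mulr1.
exists (B * M) => n.
have -> : n.+1%:R * `|a n| * rho ^+ n =
    n.+1%:R * (rho / s) ^+ n * (`|a n| * s ^+ n).
  rewrite expr_div_n; field; rewrite ?expf_neq0 ?gt_eqF//.
apply: ler_pM => //; first by rewrite mulr_ge0.
by rewrite mulr_ge0// exprn_ge0// ltW.
Qed.

Lemma rad_shift a r : rad a r -> rad (shift_coef a) r.
Proof.
move=> ar rho rr; have [M aM] := ar _ rr; case/andP: rr => r0 _.
have M0 : 0 <= M by apply: le_trans (aM 0%N); rewrite expr0 mulr1.
exists (M * rho) => -[|n] /=; first by rewrite normr0 mul0r mulr_ge0// ltW.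
by rewrite exprSr mulrA ler_wpM2r// ltW.
Qed.

Lemma rad_diffs a r : rad a r -> rad (pseries_diffs a) r.
Proof.
move=> ar rho rr; have [M aM] := rad_natM rr ar; case/andP: rr => r0 _.
exists (M / rho) => n.
rewrite ler_pdivlMr// -mulrA -exprSr /pseries_diffs normrM ger0_norm//.
apply: le_trans (aM n.+1); rewrite -!mulrA ler_wpM2r ?ler_nat//.
by rewrite mulr_ge0// exprn_ge0// ltW.
Qed.

(** At a radius s between rho and r each of the n + 1 products is at most M * N; the factor n + 1 is
    absorbed by (rho / s)^n. *)
Lemma rad_conv a b r : rad a r -> rad b r -> rad (conv a b) r.
Proof.
move=> ar br rho rr; have /andP[r0 rr'] := rr.
have [|s /andP[s0 sr] rs] := @rad_mid r rho; first by rewrite gtr0_norm.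
rewrite gtr0_norm// in rs.
have [|M aM] := ar s; first by rewrite s0.
have [|N bN] := br s; first by rewrite s0.
have M0 : 0 <= M by apply: le_trans (aM 0%N); rewrite expr0 mulr1.
have N0 : 0 <= N by apply: le_trans (bN 0%N); rewrite expr0 mulr1.
have [|B qB] := @natrM_expr_bounded (rho / s).
  by rewrite divr_ge0 ?ltW// ltr_pdivrMr// mul1r.
have q0 n : 0 <= (rho / s) ^+ n by rewrite exprn_ge0// divr_ge0 ?ltW.
exists (B * (M * N)) => n.
have -> : rho ^+ n = (rho / s) ^+ n * s ^+ n.
  by rewrite expr_div_n divfK// expf_neq0 ?gt_eqF.
rewrite mulrCA.
apply: (@le_trans _ _ ((rho / s) ^+ n * (n.+1%:R * (M * N)))); last first.
  by rewrite mulrCA mulrA ler_wpM2r ?mulr_ge0.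
rewrite ler_wpM2l//.
apply: le_trans (ler_wpM2r (exprn_ge0 n (ltW s0)) (ler_norm_sum _ _ _)) _.
rewrite mulr_suml mulr_natl -[X in _ *+ X](card_ord n.+1) -sumr_const.
apply: ler_sum => i _; rewrite normrM.
have leni : (i <= n)%N by rewrite -ltnS.
rewrite -[X in s ^+ X](subnKC leni) exprD mulrACA.
by apply: ler_pM => //; rewrite mulr_ge0// exprn_ge0// ltW.
Qed.

Lemma normrM_expr c x s n : 0 < s ->
  `|c * x ^+ n| = `|c| * s ^+ n * (`|x| / s) ^+ n.
Proof.
move=> s0; rewrite normrM normrX expr_div_n; field.
by rewrite expf_neq0 ?gt_eqF.
Qed.

Lemma rad_cvg a r x : rad a r -> `|x| < r -> cvgn (pseries a x).
Proof.
move=> ar xr; have [s /andP[s0 sr] xs] := rad_mid xr.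
have [|M aM] := ar s; first by rewrite s0.
have M0 : 0 <= M by apply: le_trans (aM 0%N); rewrite expr0 mulr1.
have xs0 : 0 <= `|x| / s by rewrite divr_ge0// ltW.
apply: normed_cvg; rewrite /normed_series_of/=.
apply: (@series_le_cvg _ _ (geometric M (`|x| / s))) => [n|n|n|] /=.
- by [].
- by rewrite mulr_ge0// exprn_ge0.
- by rewrite (normrM_expr _ _ _ s0) ler_wpM2r ?exprn_ge0.
apply: is_cvg_geometric_series.
by rewrite ger0_norm// ltr_pdivrMr// mul1r.
Qed.

Lemma rad_PS_cvg a r x : rad a r -> `|x| < r -> pseries a x @ \oo --> PS a x.
Proof. exact: rad_cvg. Qed.

Lemma PSE a x l : pseries a x @ \oo --> l -> PS a x = l.
Proof. by move=> /cvg_lim; apply. Qed.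

(** Termwise differentiation requires the series and its first two formal derivatives to converge at
    some s beyond |x|; all three have radius at least r. *)
Lemma PS_is_derive a r x : rad a r -> `|x| < r ->
  is_derive x (1 : R) (PS a) (PS (pseries_diffs a) x).
Proof.
move=> ar xr; have [s /andP[s0 sr] xs] := rad_mid xr.
have sn : `|s| < r by rewrite gtr0_norm.
apply: (@pseries_snd_diffs _ _ s).
- exact: rad_cvg sn.
- exact: rad_cvg (rad_diffs ar) sn.
- exact: rad_cvg (rad_diffs (rad_diffs ar)) sn.
- by rewrite [ltRHS]gtr0_norm.
Qed.

Lemma PS_add a b r x : rad a r -> rad b r -> `|x| < r ->
  PS (fun n => a n + b n) x = PS a x + PS b x.
Proof.
move=> ar br xr; apply: PSE.
have -> : pseries (fun n => a n + b n) x = pseries a x \+ pseries b x.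
  apply/funext => n /=; rewrite /pseries /series/= -big_split/=.
  by apply: eq_bigr => i _; rewrite mulrDl.
by apply: cvgD; exact: rad_PS_cvg xr.
Qed.

Lemma PS_scale k a r x : rad a r -> `|x| < r ->
  PS (fun n => k * a n) x = k * PS a x.
Proof.
move=> ar xr; apply: PSE.
have -> : pseries (fun n => k * a n) x = (fun n => k * pseries a x n).
  apply/funext => n /=; rewrite /pseries /series/= mulr_sumr.
  by apply: eq_bigr => i _; rewrite mulrA.
by apply: cvgMr; exact: rad_PS_cvg xr.
Qed.

Lemma PS_shift a r x : rad a r -> `|x| < r -> PS (shift_coef a) x = x * PS a x.
Proof.
move=> ar xr; apply: PSE; rewrite -cvg_shiftS /=.
have -> : (fun n => pseries (shift_coef a) x n.+1) = (fun n => x * pseries a x n).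
  apply/funext => n /=; rewrite /pseries /series/= big_nat_recl//= mul0r add0r.
  by rewrite mulr_sumr; apply: eq_bigr => i _; rewrite exprS mulrCA.
by apply: cvgMr; exact: rad_PS_cvg xr.
Qed.

(** Both sides sum over the triangle i + j < N; passing from N to N + 1 adds the antidiagonal i + j
    = N. *)
Lemma conv_partial a b N x :
  \sum_(n < N) conv a b n * x ^+ n =
  \sum_(i < N) a i * x ^+ i * (\sum_(j < N - i) b j * x ^+ j).
Proof.
elim: N => [|N IHN]; first by rewrite !big_ord0.
rewrite big_ord_recr/= IHN.
have -> : \sum_(i < N.+1) a i * x ^+ i * (\sum_(j < N.+1 - i) b j * x ^+ j) =
    \sum_(i < N.+1) (a i * x ^+ i * (\sum_(j < N - i) b j * x ^+ j) +
                     a i * b (N - i)%N * x ^+ N).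
  apply: eq_bigr => i _; have leiN : (i <= N)%N by rewrite -ltnS.
  rewrite subSn// big_ord_recr/= mulrDr; congr (_ + _).
  by rewrite -[X in _ = _ * x ^+ X](subnKC leiN) exprD mulrACA.
rewrite big_split/= [in RHS]big_ord_recr/= subnn big_ord0 mulr0 addr0.
by rewrite /conv mulr_suml.
Qed.

(** The terms are dominated by (n + 1)(n + 2) q^n, the terms of the twice differentiated geometric
    series, which converges at q. *)
Lemma sqr_expr_cvg0 q : 0 <= q < 1 -> (fun n => n%:R ^+ 2 * q ^+ n) @ \oo --> 0.
Proof.
move=> /andP[q0 q1].
have rad1 : rad (fun=> 1) 1.
  rewrite -[X in rad _ X]invr1; apply: (@rad_geometric _ 1) => // n.
  by rewrite normr1 expr1n mulr1.
have := cvg_series_cvg_0 (rad_cvg (rad_diffs (rad_diffs rad1))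
  (_ : `|q| < 1)); rewrite ger0_norm// => /(_ q1).
apply: squeeze_cvgr; last exact: cvg_cst.
near=> n; rewrite mulr_ge0 ?exprn_ge0//= ler_wpM2r ?exprn_ge0//.
rewrite /pseries_diffs mulr1 expr2; apply: ler_pM => //; rewrite ler_nat//.
exact: leqW.
Unshelve. all: by end_near.
Qed.

(* The truncated product differs from the truncated Cauchy product by at most
   N^2 terms, each of order q^N with q < 1. *)
Lemma PS_conv a b r x : rad a r -> rad b r -> `|x| < r ->
  PS (conv a b) x = PS a x * PS b x.
Proof.
move=> ar br xr; have [s /andP[s0 sr] xs] := rad_mid xr.
have [|M aM] := ar s; first by rewrite s0.
have [|M' bM] := br s; first by rewrite s0.
have M0 : 0 <= M by apply: le_trans (aM 0%N); rewrite expr0 mulr1.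
have M'0 : 0 <= M' by apply: le_trans (bM 0%N); rewrite expr0 mulr1.
pose q := `|x| / s; have q0 : 0 <= q by rewrite divr_ge0// ltW.
have q1 : q < 1 by rewrite ltr_pdivrMr// mul1r.
have term c K n : `|c n| * s ^+ n <= K -> `|c n * x ^+ n| <= K * q ^+ n.
  by move=> cK; rewrite (normrM_expr _ _ _ s0) ler_wpM2r ?exprn_ge0.
apply: PSE.
have ab : pseries a x \* pseries b x @ \oo --> PS a x * PS b x.
  by apply: cvgM; exact: rad_PS_cvg xr.
rewrite -[X in _ --> X]addr0.
have -> : pseries (conv a b) x = (pseries a x \* pseries b x) \+
    (pseries (conv a b) x \- (pseries a x \* pseries b x)).
  by apply/funext => n /=; rewrite addrC subrK.
apply: cvgD => //; apply: norm_cvg0.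
have : (fun N => M * M' * (N%:R ^+ 2 * q ^+ N)) @ \oo --> 0.
  rewrite -[X in _ --> X](mulr0 (M * M')); apply: cvgMr.
  by apply: sqr_expr_cvg0; rewrite q0.
apply: squeeze_cvgr; last exact: cvg_cst.
near=> N; rewrite normr_ge0/=.
rewrite /pseries /series/= !big_mkord conv_partial mulr_suml -sumrB.
apply: le_trans (ler_norm_sum _ _ _) _.
have -> : M * M' * (N%:R ^+ 2 * q ^+ N) =
    \sum_(i < N) (M * M' * (N%:R * q ^+ N)).
  by rewrite sumr_const card_ord -[in RHS]mulr_natr; ring.
apply: ler_sum => i _; have leiN : (i <= N)%N by exact: ltnW.
have -> : M * M' * (N%:R * q ^+ N) = M * q ^+ i * (N%:R * (M' * q ^+ (N - i))).
  have -> : q ^+ N = q ^+ i * q ^+ (N - i) by rewrite -exprD subnKC.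
  by ring.
rewrite -mulrBr normrM; apply: ler_pM => //; first exact: term.
(* The second factor is the tail of the series of b over N - i <= j < N: at most N terms, each at
   most M' * q^(N - i). *)
rewrite distrC -!(big_mkord xpredT (fun j => b j * x ^+ j)).
rewrite (@big_cat_nat _ _ _ (N - i)%N 0%N N)/= ?leq_subr// addrAC subrr add0r.
apply: le_trans (ler_norm_sum _ _ _) _.
apply: (@le_trans _ _ (\sum_(N - i <= j < N) M' * q ^+ (N - i))).
  apply: ler_sum_nat => j /andP[lej _]; apply: le_trans (term _ _ _ (bM j)) _.
  by rewrite ler_wpM2l// ler_wiXn2l// ltW.
rewrite sumr_const_nat -[leLHS]mulr_natl ler_wpM2r ?mulr_ge0 ?exprn_ge0//.
by rewrite ler_nat leq_subr.
Unshelve. all: by end_near.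
Qed.

End PowerSeries.

(** * Laurent-logarithmic functions *)

Section RealDerivatives.
Variable R : realType.
Implicit Types (f g F G : R -> R) (x : R).

Lemma derive_add f g x df dg : is_derive x 1 f df -> is_derive x 1 g dg ->
  is_derive x 1 (fun y => f y + g y) (df + dg).
Proof. exact: is_deriveD. Qed.

Lemma derive_mul f g x df dg : is_derive x 1 f df -> is_derive x 1 g dg ->
  is_derive x 1 (fun y => f y * g y) (df * g x + f x * dg).
Proof. by move=> ? ?; apply: is_derive_eq; rewrite /GRing.scale/= addrC mulrC. Qed.

Lemma derive_scale k f x df : is_derive x 1 f df ->
  is_derive x 1 (fun y => k * f y) (k * df).
Proof. exact: is_deriveZ. Qed.

Lemma derive_expr f x df n : is_derive x 1 f df ->
  is_derive x 1 (fun y => f y ^+ n) (n%:R * f x ^+ n.-1 * df).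
Proof.
move=> fd; have := @is_deriveX _ _ f n x 1 df fd.
by rewrite /GRing.scale/=; congr (is_derive _ _ _ _); apply/funext => y; rewrite fctE.
Qed.

Lemma derive_lnN x : x < 0 -> is_derive x 1 (fun y => ln (- y)) x^-1.
Proof.
move=> x0; have Nx0 : 0 < - x by rewrite oppr_gt0.
have := @is_derive1_comp _ _ _ _ _ _ (is_derive1_ln Nx0) (is_deriveNid x 1).
by rewrite invrN mulrN1 opprK.
Qed.

Lemma derive_exprV p x : x != 0 ->
  is_derive x 1 (fun y => (y ^+ p)^-1) (- p%:R * (x ^+ p.+1)^-1).
Proof.
move=> x0; have xp := derive_expr p (is_derive_id x (1 : R)).
have := @is_deriveV _ (fun y => y ^+ p) x _ 1 (expf_neq0 p x0) xp.
congr (is_derive _ _ _ _); rewrite /GRing.scale/= mulr1.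
(* The exponent [p.-1] of the power rule truncates at p = 0, where both sides vanish. *)
case: p xp => [|p] _ /=; first by rewrite !mul0r mulr0 oppr0 mul0r.
by rewrite !exprS; field; rewrite x0 expf_neq0.
Qed.

(** Mean value theorem between any two points; the value at the midpoint serves as the constant. *)
Lemma constant_of_derive0 F a b :
  (forall x, a < x < b -> is_derive x 1 F 0) ->
  exists k, forall x, a < x < b -> F x = k.
Proof.
move=> dF.
have aux y z : a < y -> y < z -> z < b -> F y = F z.
  move=> ay yz zb; have [t|t|c _ /eqP] := MVT (f := F) (df := fun=> 0) yz.
  - rewrite in_itv/= => /andP[yt tz]; apply: dF.
    by rewrite (lt_trans ay)//= (lt_trans tz).
  - apply: derivable_within_continuous => u; rewrite in_itv/= => /andP[yu uz].
    by apply: ex_derive; apply: dF; rewrite (lt_le_trans ay)//= (le_lt_trans uz).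
  - by rewrite mul0r subr_eq0 => /eqP.
exists (F ((a + b) / 2)) => x /andP[ax xb].
have ab : a < b := lt_trans ax xb.
have [am mb] := midf_lt ab.
by case: (ltgtP x ((a + b) / 2)) => [xm|mx|-> //]; [|apply/esym]; apply: aux.
Qed.
End RealDerivatives.

(** * Closure properties of polynomials in [ln (- x)] with Laurent coefficients *)

Section LogLaurent.
Variable R : realType.
Implicit Types (a b : nat -> R) (A : nat -> nat -> R) (f g G F : R -> R).
Implicit Types (c r x : R).

(** One pole order p is shared by all powers of the logarithm, so each Laurent coefficient is x^-p
    times a power series. *)
Definition log_laurent p d A x : R :=
  (x ^+ p)^-1 * \sum_(j < d) PS (A j) x * ln (- x) ^+ j.

Definition log_laurent_near0 f := exists delta p d A,
  [/\ 0 < delta, forall j, rad (A j) delta &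
      forall x, - delta < x < 0 -> f x = log_laurent p d A x].

Lemma ltr_norm_near0 (delta x : R) : - delta < x < 0 -> `|x| < delta.
Proof. by move=> /andP[dx x0]; rewrite ltr0_norm// ltrNl. Qed.

Lemma rad0 r : rad (fun=> 0 : R) r.
Proof. by move=> rho _; exists 0 => n; rewrite normr0 mul0r. Qed.

Lemma PS0 x : PS (fun=> 0 : R) x = 0.
Proof.
apply: PSE; rewrite [X in X @ _](_ : _ = cst 0); first exact: cvg_cst.
by apply/funext => n; rewrite /pseries /series/= big1// => i _; rewrite mul0r.
Qed.

Lemma PS_monomial p c x : PS (fun n => if n == p then c else 0) x = c * x ^+ p.
Proof.
apply: PSE; apply: cvg_near_cst; near=> n.
rewrite /pseries /series/= big_mkord.
have pn : (p < n)%N by near: n; exact: nbhs_infty_gt.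
rewrite (bigD1 (Ordinal pn))//= eqxx big1 ?addr0// => i /eqP ip.
by case: eqP => [ei|]; [case: ip; apply: val_inj|rewrite mul0r].
Unshelve. all: by end_near.
Qed.

Lemma rad_monomial p c r : rad (fun n => if n == p then c else 0) r.
Proof.
move=> rho /andP[r0 _]; exists (`|c| * rho ^+ p) => n.
case: eqP => [->//|_]; by rewrite normr0 mul0r mulr_ge0// exprn_ge0// ltW.
Qed.

(** Raises the pole order by k while multiplying the numerators by x^k; this brings two such
    functions to a common pole order. *)
Lemma log_laurent_shift k p d A r x : (forall j, rad (A j) r) -> `|x| < r ->
  x != 0 -> log_laurent (k + p) d (fun j => iter k (@shift_coef R) (A j)) x =
  log_laurent p d A x.
Proof.
move=> Ar xr x0; elim: k => //= k <-.
have Ak j : rad (iter k (@shift_coef R) (A j)) r.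
  by elim: k => //= k IH; exact: rad_shift.
rewrite addSn /log_laurent exprS invfM [x^-1 * _]mulrC -mulrA; congr (_ * _).
rewrite mulr_sumr; apply: eq_bigr => j _.
by rewrite (PS_shift (Ak j) xr) -mulrA mulKf.
Qed.

Lemma log_laurent_widen k p d A x :
  log_laurent p (d + k) (fun j => if (j < d)%N then A j else fun=> 0) x =
  log_laurent p d A x.
Proof.
rewrite /log_laurent big_split_ord/= [X in _ + X]big1 ?addr0 => [|i _].
  by congr (_ * _); apply: eq_bigr => i _; rewrite ltn_ord.
by rewrite ltnNge leq_addr/= PS0 mul0r.
Qed.

Lemma near0_eq f g : (forall x, x < 0 -> f x = g x) ->
  log_laurent_near0 f -> log_laurent_near0 g.
Proof.
move=> fg [delta [p [d [A [d0 Ar fE]]]]]; exists delta, p, d, A; split => // x xd.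
by rewrite -fg ?fE//; case/andP: xd.
Qed.

Lemma near0_eq_near delta f g : 0 < delta ->
  (forall x, - delta < x < 0 -> f x = g x) ->
  log_laurent_near0 f -> log_laurent_near0 g.
Proof.
move=> e0 fg [delta' [p [d [A [d0 Ar fE]]]]].
exists (Num.min delta delta'), p, d, A; split => //.
- by rewrite lt_min e0.
- by move=> j; apply: rad_le (Ar j); rewrite ge_min lexx orbT.
move=> x; rewrite ltrNl lt_min => /andP[/andP[xd xd'] x0].
by rewrite -fg ?fE// ltrNl ?xd ?xd'.
Qed.

(** Both functions are rewritten with pole order p + p' and, after padding with zero series, with d
    + d' powers of the logarithm; then the coefficients are added. *)
Lemma near0_add f g : log_laurent_near0 f -> log_laurent_near0 g ->
  log_laurent_near0 (fun x => f x + g x).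
Proof.
move=> [e [p [d [A [e0 Ar fE]]]]] [e' [p' [d' [A' [e'0 A'r gE]]]]].
pose W d (A : nat -> nat -> R) j := if (j < d)%N then A j else fun=> 0.
pose S k A j := iter k (@shift_coef R) (A j).
have WSr k d1 B r : (forall j, rad (B j) r) -> forall j, rad (W d1 (S k B) j) r.
  move=> Br j; rewrite /W; case: ifP => _; last exact: rad0.
  by rewrite /S; elim: k => //= k IH; exact: rad_shift.
exists (Num.min e e'), (p' + p)%N, (d + d')%N,
  (fun j n => W d (S p' A) j n + W d' (S p A') j n); split => //.
- by rewrite lt_min e0.
- move=> j; apply: rad_add.
    by apply: rad_le (WSr _ _ _ _ Ar j); rewrite ge_min lexx.
  by apply: rad_le (WSr _ _ _ _ A'r j); rewrite ge_min lexx orbT.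
move=> x; rewrite ltrNl lt_min => /andP[/andP[xd xd'] x0].
have xe : `|x| < e by rewrite ltr0_norm.
have xe' : `|x| < e' by rewrite ltr0_norm.
have xn0 : x != 0 by rewrite lt_eqF.
rewrite (fE x) 1?(gE x); last 2 first.
- by rewrite ltrNl xd'.
- by rewrite ltrNl xd.
rewrite -(log_laurent_shift p' p d Ar xe xn0) -(log_laurent_shift p p' d' A'r xe' xn0).
rewrite -(log_laurent_widen d') -(log_laurent_widen d (p + p')) (addnC p p') (addnC d' d).
rewrite /log_laurent -mulrDr -big_split/=; congr (_ * _).
apply: eq_bigr => j _; rewrite -mulrDl; congr (_ * _).
rewrite (PS_add (r := Num.min e e')) ?lt_min ?xe//.
- by apply: rad_le (WSr _ _ _ _ Ar j); rewrite ge_min lexx.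
- by apply: rad_le (WSr _ _ _ _ A'r j); rewrite ge_min lexx orbT.
Qed.

Lemma near0_mul_PS b r p' f : 0 < r -> rad b r -> log_laurent_near0 f ->
  log_laurent_near0 (fun x => (x ^+ p')^-1 * PS b x * f x).
Proof.
move=> r0 br [e [p [d [A [e0 Ar fE]]]]].
exists (Num.min r e), (p' + p)%N, d, (fun j => conv b (A j)).
have Ar' j : rad (A j) (Num.min r e).
  by apply: rad_le (Ar j); rewrite ge_min lexx orbT.
have br' : rad b (Num.min r e) by apply: rad_le br; rewrite ge_min lexx.
split => [|j|x].
- by rewrite lt_min r0.
- exact: rad_conv.
move=> xre; have xn := ltr_norm_near0 xre.
move: xre; rewrite ltrNl lt_min => /andP[/andP[xd xd'] x0].
rewrite fE; last by rewrite ltrNl xd'.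
rewrite /log_laurent exprD invfM -!mulrA; congr (_ * _).
rewrite mulrCA; congr (_ * _); rewrite mulr_sumr; apply: eq_bigr => j _.
by rewrite mulrA (PS_conv br' (Ar' j) xn).
Qed.

Lemma near0_log_monomial a r p j : 0 < r -> rad a r ->
  log_laurent_near0 (fun x => (x ^+ p)^-1 * PS a x * ln (- x) ^+ j).
Proof.
move=> r0 ar; exists r, p, j.+1, (fun i => if i == j then a else fun=> 0).
split => // [i|x _]; first by case: ifP => _; [|exact: rad0].
rewrite /log_laurent big_ord_recr/= eqxx big1 ?add0r ?mulrA// => i _.
by rewrite ltn_eqF// PS0 mul0r.
Qed.

Lemma near0_log_expr c j : log_laurent_near0 (fun x => c * ln (- x) ^+ j).
Proof.
apply: near0_eq (near0_log_monomial 0 j ltr01 (@rad_monomial 0 c 1)) => x _.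
by rewrite PS_monomial !expr0 invr1 mul1r mulr1.
Qed.

Lemma near0_cst c : log_laurent_near0 (fun=> c).
Proof. by apply: near0_eq (near0_log_expr c 0) => x _; rewrite mulr1. Qed.

Lemma near0_scale c f : log_laurent_near0 f -> log_laurent_near0 (fun x => c * f x).
Proof.
move=> /(near0_mul_PS 0 ltr01 (@rad_monomial 0 c 1)); apply: near0_eq => x _.
by rewrite PS_monomial !expr0 invr1 mul1r mulr1.
Qed.

(* Integration by parts lowers the power of the logarithm; the term of degree
   -1 of the Laurent series is what raises it. *)
Lemma primitive_log_monomial a r p j : 0 < r -> rad a r ->
  exists2 G, log_laurent_near0 G & forall x, - r < x < 0 ->
    is_derive x 1 G ((x ^+ p.+1)^-1 * PS a x * ln (- x) ^+ j).
Proof.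
move=> r0.
(* One integration by parts: x^-p times the series of b is a primitive of the Laurent series without
   its term a'_p / x, and differentiating the logarithm leaves a term of log degree one lower. *)
have step j' a' : rad a' r -> exists b, rad b r /\ forall x, - r < x < 0 ->
    is_derive x 1 (fun y => (y ^+ p)^-1 * PS b y * ln (- y) ^+ j')
      ((x ^+ p.+1)^-1 * PS a' x * ln (- x) ^+ j' - a' p * x^-1 * ln (- x) ^+ j' +
       j'%:R * ((x ^+ p.+1)^-1 * PS b x * ln (- x) ^+ j'.-1)).
  (* The monomial x^(n - p - 1) has primitive x^(n - p) / (n - p) unless n = p; as |n - p| >= 1
     otherwise, the radius does not shrink. *)
  move=> {}ar'; pose b n := if n == p then 0 else a' n / (n%:R - p%:R) : R.
  have br : rad b r.
    apply: (@rad_dominated _ 1 a') => // n; rewrite mul1r /b.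
    case: eqP => [_|/eqP np]; first by rewrite normr0.
    rewrite normrM normfV ler_pdivrMr; last first.
      by rewrite normr_gt0 subr_eq0 eqr_nat.
    rewrite ler_peMr//; case: (ltnP n p) => [lt|].
      by rewrite distrC -natrB 1?ltnW// normr_nat ler1n subn_gt0.
    rewrite leq_eqVlt eq_sym (negbTE np)/= => lt.
    by rewrite -natrB 1?ltnW// normr_nat ler1n subn_gt0.
  exists b; split => // x xr; have xn := ltr_norm_near0 xr.
  have x0 : x < 0 by case/andP: xr.
  have xn0 : x != 0 by rewrite lt_eqF.
  have key : x * PS (pseries_diffs b) x - p%:R * PS b x = PS a' x - a' p * x ^+ p.
    rewrite -(PS_shift (rad_diffs br) xn) -mulNr -(PS_scale _ br xn).
    rewrite -(PS_add (rad_shift (rad_diffs br)) (rad_scale (- p%:R) br) xn).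
    rewrite -mulNr -PS_monomial.
    rewrite -(PS_add ar' (rad_monomial p (- a' p) (r := r)) xn).
    congr (PS _ _); apply/funext => n.
    have -> : shift_coef (pseries_diffs b) n = n%:R * b n.
      by case: n => [|n] /=; rewrite ?mul0r.
    rewrite mulNr -mulrBl /b; case: eqP => [->|/eqP np]; first by rewrite mulr0 subrr.
    by rewrite addr0 mulrC divfK// subr_eq0 eqr_nat.
  have d1 := derive_mul (derive_mul (derive_exprV p xn0) (PS_is_derive br xn))
    (derive_expr j' (derive_lnN x0)).
  apply: is_derive_eq d1 _.
  have -> : PS a' x = x * PS (pseries_diffs b) x - p%:R * PS b x + a' p * x ^+ p.
    by rewrite key subrK.
  rewrite !exprS; field; rewrite xn0 expf_neq0//.
elim: j a => [|j IHj] a ar.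
  have [b [br bE]] := step 0%N _ ar.
  exists (fun y => (y ^+ p)^-1 * PS b y * ln (- y) ^+ 0 + a p * ln (- y) ^+ 1).
    by apply: near0_add; [exact: near0_log_monomial _ _ r0 br|exact: near0_log_expr].
  move=> x xr; have x0 : x < 0 by case/andP: xr.
  apply: is_derive_eq (derive_add (bE x xr)
    (derive_scale (a p) (derive_expr 1 (derive_lnN x0)))) _.
  by rewrite mul0r addr0 /= !expr0 !mul1r !mulr1 subrK.
have [b [br bE]] := step j.+1 _ ar.
have [G G0 GE] := IHj _ br.
(* The second summand integrates the residue term a_p / x times the logarithm power; the third
   cancels the lower-degree remainder of [step]. *)
exists (fun y => (y ^+ p)^-1 * PS b y * ln (- y) ^+ j.+1 +
  (a p / j.+2%:R * ln (- y) ^+ j.+2 + (- j.+1%:R) * G y)).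
  apply: near0_add; first exact: near0_log_monomial _ _ r0 br.
  by apply: near0_add; [exact: near0_log_expr|exact: near0_scale].
move=> x xr; have x0 : x < 0 by case/andP: xr.
apply: is_derive_eq (derive_add (bE x xr) (derive_add
  (derive_scale _ (derive_expr j.+2 (derive_lnN x0))) (derive_scale _ (GE x xr)))) _.
rewrite /=; field.
have j2 : 2 + j%:R != 0 :> R by rewrite -[2]/(2%:R) -natrD pnatr_eq0.
have xn0 : x != 0 by rewrite lt_eqF.
by rewrite j2 xn0 expf_neq0.
Qed.

(** A primitive G is assembled one power of the logarithm at a time; F - G is then constant on (-r,
    0). *)
Lemma near0_primitive f F : log_laurent_near0 f ->
  (forall x, x < 0 -> is_derive x 1 F (f x)) -> log_laurent_near0 F.
Proof.
move=> [r [p [d [A [r0 Ar fE]]]]] dF.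
(* The same function is written with pole order p + 1 and shifted numerators, since
   [primitive_log_monomial] asks for a positive pole order. *)
have [G G0 dG] : exists2 G, log_laurent_near0 G & forall x, - r < x < 0 ->
    is_derive x 1 G (log_laurent p.+1 d (fun j => shift_coef (A j)) x).
  elim: d {fE} => [|d [G G0 dG]].
    exists (fun=> 0); first exact: near0_cst.
    by move=> x _; rewrite /log_laurent big_ord0 mulr0; exact: is_derive_cst.
  have [H H0 dH] := primitive_log_monomial p d r0 (rad_shift (Ar d)).
  exists (fun x => G x + H x); first exact: near0_add.
  move=> x xr; apply: is_derive_eq (derive_add (dG x xr) (dH x xr)) _.
  by rewrite /log_laurent big_ord_recr/= mulrDr mulrA.
have [k kE] : exists k, forall x, - r < x < 0 -> F x + (-1) * G x = k.
  apply: constant_of_derive0 => x xr; have x0 : x < 0 by case/andP: xr.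
  apply: is_derive_eq (derive_add (dF x x0) (derive_scale (-1) (dG x xr))) _.
  rewrite -[p.+1]/(1 + p)%N (log_laurent_shift 1 p d Ar (ltr_norm_near0 xr)) ?lt_eqF//.
  by rewrite fE// mulN1r subrr.
apply: (@near0_eq_near r (fun x => k + G x)) => //.
  by move=> x xr; rewrite -(kE x xr) mulN1r subrK.
by apply: near0_add => //; exact: near0_cst.
Qed.

End LogLaurent.

(** * Multiple polylogarithms on the negative half-line *)

Section InversePowerSeries.
Variable R : realType.
Implicit Types (u : nat -> R).

(** Each coefficient of the reciprocal depends on all earlier ones, so the recursion carries the
    whole list of the first n. *)
Fixpoint inv_coefs u n : seq R :=
  if n is m.+1 then
    let v := inv_coefs u m in
    rcons v (if m == 0%N then 1 else - \sum_(i < m) v`_i * u (m - i)%N)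
  else [::].

Definition inv_coef u n : R := (inv_coefs u n.+1)`_n.

Lemma size_inv_coefs u n : size (inv_coefs u n) = n.
Proof. by elim: n => //= n IHn; rewrite size_rcons IHn. Qed.

Lemma nth_inv_coefs u n i : (i < n)%N -> (inv_coefs u n)`_i = inv_coef u i.
Proof.
elim: n => // n IHn; rewrite ltnS leq_eqVlt => /predU1P[-> //|lt].
by rewrite /= nth_rcons size_inv_coefs lt IHn.
Qed.

Lemma inv_coef0 u : inv_coef u 0 = 1.
Proof. by []. Qed.

Lemma inv_coefS u n : inv_coef u n.+1 = - \sum_(i < n.+1) inv_coef u i * u (n.+1 - i)%N.
Proof.
rewrite {1}/inv_coef -[inv_coefs u n.+2]/(rcons (inv_coefs u n.+1) _).
rewrite nth_rcons size_inv_coefs ltnn eqxx /=; congr (- _).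
by apply: eq_bigr => i _; rewrite -[rcons _ _]/(inv_coefs u n.+1) nth_inv_coefs.
Qed.

Lemma conv_inv_coef u : u 0%N = 1 ->
  conv (inv_coef u) u = (fun n => if n == 0%N then 1 else 0).
Proof.
move=> u0; apply/funext => -[|n] /=; rewrite /conv big_ord_recr/=.
  by rewrite big_ord0 add0r inv_coef0 subn0 u0 mulr1.
by rewrite subnn u0 mulr1 inv_coefS subrr.
Qed.

(** By the recursion |v_(n+1)| <= 1 + 2 + ... + 2^n < 2^(n+1). This is where the radius 1/2 comes
    from. *)
Lemma norm_inv_coef u n : (forall i, `|u i| <= 1) -> `|inv_coef u n| <= 2 ^+ n.
Proof.
move=> u1; elim/ltn_ind: n => -[|n] IHn; first by rewrite inv_coef0 normr1.
rewrite inv_coefS normrN (le_trans (ler_norm_sum _ _ _))//.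
apply: (@le_trans _ _ (\sum_(i < n.+1) 2 ^+ i)).
  by apply: ler_sum => i _; rewrite normrM -[leRHS]mulr1 ler_pM// IHn.
have := subrX1 (2 : R) n.+1; rewrite (_ : 2 - 1 = 1 :> R) ?mul1r => [<-|]; last by ring.
by rewrite lerBlDr lerDl.
Qed.

Lemma inverse_power_series u : u 0%N = 1 -> (forall n, `|u n| <= 1) ->
  exists2 v, rad v 2^-1 & forall x, `|x| < 2^-1 -> PS v x * PS u x = 1.
Proof.
move=> u0 u1; have rv : rad (inv_coef u) 2^-1.
  by apply: (@rad_geometric _ _ 1) => // n; rewrite mul1r norm_inv_coef.
exists (inv_coef u) => // x x2.
have ru : rad u 2^-1.
  by apply: (@rad_geometric _ _ 1) => // n; rewrite mul1r (le_trans (u1 n))// exprn_ege1// ler1n.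
by rewrite -(PS_conv rv ru x2) conv_inv_coef// PS_monomial mulr1.
Qed.

End InversePowerSeries.

(** * Real polylogarithms: recursions, decay at -oo, expansion at 0 *)

Section RealPolylog.
Variable R : realType.
Implicit Types (x : R).

(** Truncated multiple harmonic sum over n > m_1 > m_2 > ... >= 1. *)
Fixpoint nested_sum (s : seq nat) (n : nat) : R :=
  if s is k :: s' then \sum_(1 <= m < n) (m%:R ^+ k)^-1 * nested_sum s' m else 1.

(** Coefficient of z^n in Li_s(z). The value at n = 0 is set apart because the formula would give 1
    there for the symbol [0]. *)
Definition polylog_coef (s : nat * seq nat) (n : nat) : R :=
  if n == 0%N then 0 else (n%:R ^+ s.1)^-1 * nested_sum s.2 n.

(* The variable is the exponent: [polylog s x] is Li_s(e^x). *)
Definition polylog (s : nat * seq nat) (x : R) : R := PS (polylog_coef s) (expR x).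

(** Every symbol arises from [0] by prepending 0 and by raising the first entry, that is, by
    multiplication by [0] and by I. *)
Lemma symb_ind (P : nat * seq nat -> Prop) : P (0%N, [::]) ->
  (forall k s, P (k, s) -> P (0%N, k :: s)) ->
  (forall k s, P (k, s) -> P (k.+1, s)) -> forall s, P s.
Proof.
move=> P0 PC PS [k s]; elim: s k => [|j s IHs]; elim=> [|k IHk] //.
- exact: PS.
- exact: PC.
- exact: PS.
Qed.

Lemma nested_sum_ge0 (s : seq nat) n : 0 <= nested_sum s n.
Proof. by elim: s n => //= k s IHs n; apply: sumr_ge0 => m _; rewrite mulr_ge0 ?invr_ge0 ?exprn_ge0. Qed.

Lemma polylog_coef_ge0 s n : 0 <= polylog_coef s n.
Proof.
rewrite /polylog_coef; case: eqP => // _.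
by rewrite mulr_ge0 ?nested_sum_ge0// invr_ge0 exprn_ge0.
Qed.

Lemma polylog_coefS k s n : n%:R * polylog_coef (k.+1, s) n = polylog_coef (k, s) n.
Proof.
rewrite /polylog_coef; case: eqP => [->|/eqP n0]; first by rewrite mul0r.
have n0' : n%:R != 0 :> R by rewrite pnatr_eq0.
by rewrite /= exprS invfM mulrA mulrA mulfV// mul1r.
Qed.

(** Convolution with the coefficients of z / (1 - z) forms partial sums; its zero constant term
    makes the inequality m < n strict. *)
Lemma polylog_coef_cons k s :
  polylog_coef (0%N, k :: s) = conv (polylog_coef (k, s)) (polylog_coef (0%N, [::])).
Proof.
apply/funext => n; rewrite /conv big_ord_recr/= subnn mulr0 addr0.
case: n => [|n]; first by rewrite big_ord0.
rewrite big_ord_recl/= mul0r add0r.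
rewrite {1}/polylog_coef/= expr0 invr1 mul1r big_add1/= big_mkord.
apply: eq_bigr => i _; rewrite /polylog_coef/= subn_eq0 leqNgt.
by rewrite ltnS ltn_ord/= expr0 invr1 !mulr1.
Qed.

Lemma polylog_coef_nil : polylog_coef (0%N, [::]) = shift_coef (fun=> 1).
Proof.
by apply/funext => -[|n]; rewrite /polylog_coef//= expr0 invr1 mulr1.
Qed.

Lemma rad1 : rad (fun=> 1 : R) 1.
Proof.
rewrite -[X in rad _ X]invr1; apply: (@rad_geometric _ _ 1) => // n.
by rewrite normr1 expr1n mulr1.
Qed.

Lemma PS1 x : `|x| < 1 -> PS (fun=> 1 : R) x = (1 - x)^-1.
Proof.
move=> x1; by apply: PSE; rewrite -[X in _ --> X]mul1r; exact: cvg_geometric_series.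
Qed.

Lemma rad_polylog s : rad (polylog_coef s) 1.
Proof.
elim/symb_ind: s => [|k s IH|k s IH].
- by rewrite polylog_coef_nil; exact/rad_shift/rad1.
- rewrite polylog_coef_cons; apply: rad_conv => //.
  by rewrite polylog_coef_nil; exact/rad_shift/rad1.
apply: (@rad_dominated _ 1 (polylog_coef (k, s))) => // n.
rewrite mul1r -(polylog_coefS k) normrM normr_nat; case: n => [|n].
  by rewrite /polylog_coef/= normr0 mulr0.
by rewrite ler_peMl// ler1n.
Qed.

Lemma norm_expR_lt1 (x : R) : x < 0 -> `|expR x| < 1.
Proof. by move=> x0; rewrite ger0_norm ?expR_ge0// expR_lt1. Qed.

Lemma polylog_nil x : x < 0 -> polylog (0%N, [::]) x = expR x / (1 - expR x).
Proof.
move=> /norm_expR_lt1 x1.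
by rewrite /polylog polylog_coef_nil (PS_shift rad1)// PS1.
Qed.

Lemma polylog_cons k s x : x < 0 ->
  polylog (0%N, k :: s) x = polylog (0%N, [::]) x * polylog (k, s) x.
Proof.
move=> /norm_expR_lt1 x1.
by rewrite /polylog polylog_coef_cons (PS_conv (rad_polylog _) (rad_polylog _)) 1?mulrC.
Qed.

Lemma polylog_is_derive k s x : x < 0 ->
  is_derive x 1 (polylog (k.+1, s)) (polylog (k, s) x).
Proof.
move=> /norm_expR_lt1 x1; have rk := rad_polylog (k.+1, s).
apply: is_derive_eq (is_derive1_comp (PS_is_derive rk x1) (is_derive_expR x)) _.
rewrite mulrC -(PS_shift (rad_diffs rk) x1); congr (PS _ _); apply/funext => -[|n] //=.
by rewrite -polylog_coefS.
Qed.

Lemma polylog_continuous s x : x < 0 -> {for x, continuous (polylog s)}.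
Proof.
move=> /norm_expR_lt1 x1; apply/differentiable_continuous/derivable1_diffP.
exact/ex_derive/(is_derive1_comp (PS_is_derive (rad_polylog _) x1) (is_derive_expR x)).
Qed.

Lemma polylog_ge0 s x : x < 0 -> 0 <= polylog s x.
Proof.
move=> /norm_expR_lt1 x1; apply: limr_ge; first exact: rad_cvg (rad_polylog s) x1.
near=> n; apply: sumr_ge0 => i _.
by rewrite mulr_ge0 ?polylog_coef_ge0// exprn_ge0// expR_ge0.
Unshelve. all: by end_near.
Qed.

(** The series has no constant term, so e^x factors out; the remaining series has nonnegative
    coefficients and for x <= -1 is at most its value at e^-1. *)
Lemma polylog_le_expR s : exists C, forall x, x <= -1 -> polylog s x <= C * expR x.
Proof.
pose c n := polylog_coef s n.+1.
have sc : polylog_coef s = shift_coef c by apply/funext => -[].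
have rc : rad c 1.
  have := rad_diffs (rad_polylog s); apply: (@rad_dominated _ 1) => // n.
  by rewrite mul1r /pseries_diffs [leRHS]normrM [X in X * _]ger0_norm// ler_peMl// ler1n.
exists (PS c (expR (-1))) => x x1.
have x0 : x < 0 by apply: le_lt_trans x1 _; rewrite oppr_lt0.
rewrite /polylog sc (PS_shift rc (norm_expR_lt1 x0)) mulrC.
apply: ler_wpM2r; first exact: expR_ge0.
apply: ler_lim.
- exact: rad_cvg rc (norm_expR_lt1 x0).
- by apply: rad_cvg rc (norm_expR_lt1 _); rewrite oppr_lt0.
near=> n; apply: ler_sum => i _; apply: ler_wpM2l; first exact: polylog_coef_ge0.
by apply: lerXn2r; rewrite ?nnegrE ?expR_ge0// ler_expR.
Unshelve. all: by end_near.
Qed.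

(** With t = -x, the bound e^t >= t^(n+1) / (n+1)! turns C * t^n * e^-t into at most C * (n+1)! /
    t. *)
Lemma polylog_decay n s : (fun x => x ^+ n * polylog s x) @ -oo --> 0.
Proof.
have [C CP] := polylog_le_expR s.
have C0 : 0 <= C.
  have := CP (-1) (lexx _); rewrite -ler_pdivrMr ?expR_gt0//; apply: le_trans.
  by rewrite divr_ge0 ?expR_ge0// polylog_ge0// oppr_lt0.
pose K := C * n.+1`!%:R; apply: norm_cvg0; apply/cvgNy_compNP.
have lim : (fun t : R => K / t) @ +oo --> 0.
  rewrite -[X in _ --> X](mulr0 K); apply: cvgMr.
  apply: (gtr0_cvgV0 (f := id) _).2; last exact: cvg_id.
  exact: nbhs_pinfty_gt.
apply: squeeze_cvgr lim; last exact: cvg_cst.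
near=> t; rewrite /= normr_ge0/=.
have t1 : 1 <= t by near: t; exact: nbhs_pinfty_ge.
have t0 : 0 < t by exact: lt_le_trans t1.
have Nt : - t < 0 by rewrite oppr_lt0.
rewrite normrM normrX normrN (gtr0_norm t0) (ger0_norm (polylog_ge0 _ Nt)).
apply: (@le_trans _ _ (t ^+ n * (C * expR (- t)))).
  by apply: ler_wpM2l; [exact/exprn_ge0/ltW|apply: CP; rewrite lerN2].
rewrite expRN /K mulrCA -!mulrA; apply: ler_wpM2l => //.
rewrite ler_pdivrMr ?expR_gt0// -ler_pdivrMl ?divr_gt0 ?ltr0n ?fact_gt0//.
apply: le_trans (expR_ge1Dxn n (ltW t0)).
rewrite exprS; have f0 : 0 < n.+1`!%:R :> R by rewrite ltr0n fact_gt0.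
rewrite (_ : _^-1 * _ = t * t ^+ n / n.+1`!%:R) ?lerDr//.
by field; rewrite !gt_eqF.
Unshelve. all: by end_near.
Qed.

(** Write e^-x = 1 - x * u(x) with u_n = (-1)^n / (n+1)!. Then e^x / (1 - e^x) = 1 / (e^-x - 1) = -1
    / (x * u(x)), and u has a reciprocal series. *)
Lemma polylog_nil_laurent : exists2 v, rad v 2^-1 &
  forall x, - 2^-1 < x < 0 -> polylog (0%N, [::]) x = (x ^+ 1)^-1 * PS v x.
Proof.
pose u (n : nat) : R := (-1) ^+ n / n.+1`!%:R.
have u0 : u 0%N = 1 by rewrite /u expr0 divr1.
have u1 n : `|u n| <= 1.
  rewrite /u normrM normrX normrN1 expr1n mul1r ger0_norm ?invr_ge0//.
  by rewrite invf_le1 ?ler1n ?ltr0n ?fact_gt0.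
have [v rv uv] := inverse_power_series u0 u1.
have ru : rad u 1.
  by apply: (@rad_dominated _ 1 (fun=> 1)) rad1 => // n; rewrite normr1 mulr1.
have expE x : `|x| < 1 -> expR (- x) = 1 - x * PS u x.
  move=> x1; have ru' := rad_scale (-1) ru.
  rewrite -mulNr -mulN1r -mulrA mulrCA -(PS_scale (-1) ru x1) -(PS_shift ru' x1).
  rewrite -[X in X + _](_ : PS (fun n => if n == 0%N then 1 else 0) x = 1); last first.
    by rewrite PS_monomial expr0 mulr1.
  rewrite -(PS_add (rad_monomial 0 1 (r := 1)) (rad_shift ru') x1) expRE.
  rewrite /PS; congr (limn _); apply/funext => n.
  apply: eq_bigr => -[|i] _ /=; first by rewrite !expr0 addr0 fact0 invr1.
  by rewrite add0r /u exprMn exprS; ring.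
exists (fun n => -1 * v n) => [|x xh]; first exact: rad_scale.
have xn := ltr_norm_near0 xh; have x0 : x < 0 by case/andP: xh.
have x1 : `|x| < 1 by apply: lt_trans xn _; lra.
have xn0 : x != 0 by rewrite lt_eqF.
have U0 : PS u x != 0 by apply: contra_eq_neq (uv x xn) => ->; rewrite mulr0 eq_sym oner_neq0.
have VE : PS v x = (PS u x)^-1 by rewrite -[LHS](mulfK U0) uv// mul1r.
rewrite polylog_nil// (PS_scale _ rv xn) VE expr1.
have E := expE x x1.
have ex0 : 1 - x * PS u x != 0 by rewrite -E gt_eqF ?expR_gt0.
rewrite -[x in expR x]opprK expRN E; field.
rewrite ex0 U0 xn0 /=.
by rewrite -addrA addrC subrK oppr_eq0 mulf_neq0.
Qed.

Lemma polylog_near0 s : log_laurent_near0 (polylog s).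
Proof.
have [v rv vE] := polylog_nil_laurent.
have h0 : 0 < 2^-1 :> R by rewrite invr_gt0.
elim/symb_ind: s => [|k s IH|k s IH].
- apply: (near0_eq_near h0 _ (near0_log_monomial 1 0 h0 rv)) => x xh.
  by rewrite vE// mulr1.
- apply: (near0_eq_near h0 _ (near0_mul_PS 1 h0 rv IH)) => x xh.
  by rewrite polylog_cons ?vE//; case/andP: xh.
exact: near0_primitive IH (fun x => @polylog_is_derive k s x).
Qed.

End RealPolylog.

(** * Integration over []-oo, x]] through primitives vanishing at -oo *)

Section Integral.
Variable R : realType.
Implicit Types (f F : R -> R) (t x : R).
Local Notation mu := (@lebesgue_measure R).

Lemma eq0_of_derive0 F : (forall x, x < 0 -> is_derive x 1 F 0) ->
  F @ -oo --> 0 -> forall x, x < 0 -> F x = 0.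
Proof.
move=> dF F0 x x0; apply: (@cvg_unique _ (@norm_hausdorff _ _) (F @ -oo)) => //.
apply: cvg_near_cst; near=> y.
have yx : y < x by near: y; by apply: nbhs_ninfty_lt; exact: num_real.
(* The open interval from y - 1 to 0 contains both y and x, so F y = F x for all y near -oo, and the
   limit of F is F x. *)
have [|k kE] := @constant_of_derive0 _ F (y - 1) 0.
  by move=> z /andP[_ z0]; exact: dF.
have y1 : y - 1 < y by rewrite ltrBlDr ltrDl.
by rewrite (kE x) ?(kE y)// ?y1 ?x0 ?(lt_trans yx x0) ?(lt_trans y1 yx).
Unshelve. all: by end_near.
Qed.

(** The substitution t -> -t leads to a half-line ending at +oo, where the fundamental theorem for
    nonnegative integrands applies with primitive -F(-t). *)
Lemma integral_Ny_derive f F x : x < 0 ->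
  (forall t, t < 0 -> 0 <= f t) ->
  (forall t, t < 0 -> {for t, continuous f}) ->
  (forall t, t < 0 -> is_derive t 1 F (f t)) ->
  F @ -oo --> 0 ->
  (\int[mu]_(t in `]-oo, x]) (f t)%:E = (F x)%:E)%E.
Proof.
move=> x0 f0 cf dF F0; rewrite -[x in LHS]opprK.
have ltx (t : R) : - x <= t -> - t < 0 by rewrite oppr_lt0; apply: lt_le_trans; rewrite oppr_gt0.
rewrite ge0_integration_by_substitutionNy; first last.
- move=> t; rewrite in_itv/= opprK => tx; apply: f0; exact: lt_trans tx x0.
- apply: continuous_in_subspaceT => t; rewrite inE/= in_itv/= opprK => tx.
  by apply: cf; exact: le_lt_trans tx x0.
have dG t : - x <= t -> is_derive t 1 (fun u => - F (- u)) (f (- t)).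
  move=> xt; have := is_deriveN (@is_derive1_comp _ F -%R _ _ _ (dF _ (ltx _ xt)) (is_deriveNid t 1)).
  by rewrite mulrN1 opprK.
have cG t : - x <= t -> {for t, continuous (fun u => - F (- u))}.
  by move=> /dG dGt; apply/differentiable_continuous/derivable1_diffP; exact: ex_derive.
rewrite (@ge0_continuous_FTC2y _ _ (fun u => - F (- u)) _ 0).
- by rewrite sub0e opprK EFinN oppeK.
- by move=> t /ltx /f0.
- apply: continuous_in_subspaceT => t; rewrite inE/= in_itv/= andbT => xt.
  apply: continuous_comp; first exact: opp_continuous.
  exact/cf/ltx.
- rewrite -[X in _ --> X]oppr0; apply: cvgN.
  by move/cvgNy_compNP : F0.
- by move=> t /ltW /dG ?; exact: ex_derive.
- by apply: cvg_at_right_filter; exact: cG.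
- by move=> t; rewrite in_itv/= andbT => /ltW /dG dGt; rewrite derive1E; exact: derive_val.
Qed.

Lemma integrable_Ny_derive f F x : x < 0 ->
  (forall t, t < 0 -> 0 <= f t) ->
  (forall t, t < 0 -> {for t, continuous f}) ->
  (forall t, t < 0 -> is_derive t 1 F (f t)) ->
  F @ -oo --> 0 ->
  mu.-integrable `]-oo, x] (EFin \o f).
Proof.
move=> x0 f0 cf dF F0; apply/integrableP; split.
  apply/measurable_EFinP.
  have mf : measurable_fun `]-oo, (0:R)[%classic f.
    apply: open_continuous_measurable_fun; first exact: interval_open.
    by move=> t; rewrite inE/= in_itv/=; exact: cf.
  apply: measurable_funS mf => //.
  by move=> t /=; rewrite !in_itv/= => tx; exact: le_lt_trans tx x0.
apply: (@le_lt_trans _ _ (F x)%:E); last exact: ltry.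
rewrite -(integral_Ny_derive x0 f0 cf dF F0).
rewrite le_eqVlt; apply/orP; left; apply/eqP/eq_integral => t.
rewrite inE/= in_itv/= => tx; rewrite ger0_norm// f0//; exact: le_lt_trans tx x0.
Qed.

End Integral.

(** * Linear extension: compatibility with I and with the shuffle product *)

Section RealLinearExtension.
Variable R : realType.
Implicit Types (a b : Hge0) (s t : symb) (x : R).
Local Notation mu := (@lebesgue_measure R).

(** Real counterpart of [frakL], on which the analysis is carried out. *)
Definition polylog_lin a x : R :=
  \sum_(s <- msupp a) ratr (mcoeff s a) * @polylog R s x.

Lemma polylog_linEw a (d : {fset symb}) x : fsubset (msupp a) d ->
  polylog_lin a x = \sum_(s <- d) ratr (mcoeff s a) * @polylog R s x.
Proof.
move=> le; rewrite [LHS](big_fset_incl _ le) => //= s sd /mcoeff_outdom ->.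
by rewrite rmorph0 mul0r.
Qed.

Lemma polylog_lin_bas s : polylog_lin (bas s) = @polylog R s.
Proof.
apply/funext => x.
by rewrite (polylog_linEw _ msuppU_le) big_seq_fset1 mcoeffUU rmorph1 mul1r.
Qed.

Lemma polylog_lin0 : polylog_lin 0 = fun=> 0.
Proof. by apply/funext => x; rewrite /polylog_lin msupp0 big_seq_fset0. Qed.

Lemma polylog_linDZ (q : rat) a b :
  polylog_lin (q *: a + b) = fun x => ratr q * polylog_lin a x + polylog_lin b x.
Proof.
apply/funext => x; pose d := (msupp a `|` msupp b)%fset.
rewrite !(@polylog_linEw _ d) ?fsubsetUl ?fsubsetUr//; last first.
  apply: fsubset_trans (msuppD_le _ _) _; rewrite /d.
  by apply: fsetSU; apply: msuppZ_le.
rewrite mulr_sumr -big_split; apply: eq_bigr => s _ /=.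
by rewrite mcoeffD mcoeffZ rmorphD rmorphM/= mulrDl mulrA.
Qed.

Lemma polylog_linD a b :
  polylog_lin (a + b) = fun x => polylog_lin a x + polylog_lin b x.
Proof. by rewrite -[a in LHS]scale1r polylog_linDZ; apply/funext => x; rewrite rmorph1 mul1r. Qed.

Lemma polylog_lin_near0 a : log_laurent_near0 (polylog_lin a).
Proof.
elim/malg_ind: a => [|q a b IHa IHb|s].
- by rewrite polylog_lin0; exact: near0_cst.
- by rewrite polylog_linDZ; apply: near0_add => //; exact: near0_scale.
- by rewrite polylog_lin_bas; exact: polylog_near0.
Qed.

Lemma polylog_lin_decay n a : (fun x => x ^+ n * polylog_lin a x) @ -oo --> 0.
Proof.
elim/malg_ind: a => [|q a b IHa IHb|s].
- by rewrite polylog_lin0; under eq_fun do rewrite mulr0; exact: cvg_cst.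
- rewrite polylog_linDZ.
  have -> : (fun x => x ^+ n * (ratr q * polylog_lin a x + polylog_lin b x)) =
      (fun x => ratr q * (x ^+ n * polylog_lin a x) + x ^+ n * polylog_lin b x).
    by apply/funext => x; rewrite mulrDr mulrCA.
  have qa : (fun x => ratr q * (x ^+ n * polylog_lin a x)) @ -oo --> 0.
    by rewrite -[X in _ --> X](mulr0 (ratr q)); exact: cvgMr.
  by rewrite -[X in _ --> X](addr0 0); apply: cvgD qa IHb.
- by rewrite polylog_lin_bas; exact: polylog_decay.
Qed.

Lemma polylog_lin_continuous a x : x < 0 -> {for x, continuous (polylog_lin a)}.
Proof.
move=> x0; elim/malg_ind: a => [|q a b IHa IHb|s].
- by rewrite polylog_lin0; exact: cst_continuous.
- rewrite polylog_linDZ; apply: continuousD => //.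
  by apply: continuousM => //; exact: cst_continuous.
- by rewrite polylog_lin_bas; exact: polylog_continuous.
Qed.

Lemma polylog_lin_Iop_is_derive a x : x < 0 ->
  is_derive x 1 (polylog_lin (Iop a)) (polylog_lin a x).
Proof.
move=> x0; elim/malg_ind: a => [|q a b IHa IHb|[k s]].
- by rewrite /Iop linear0 polylog_lin0; exact: is_derive_cst.
- rewrite /Iop linext_is_linear !polylog_linDZ.
  by apply: derive_add => //; exact: derive_scale.
- by rewrite /Iop linext_bas !polylog_lin_bas; exact: polylog_is_derive.
Qed.

Lemma cvg_polylog0 s : @polylog R s @ -oo --> 0.
Proof.
have -> : @polylog R s = (fun x => x ^+ 0 * @polylog R s x).
  by apply/funext => x; rewrite expr0 mul1r.
exact: polylog_decay.
Qed.

Lemma cvg_polylog_lin0 a : polylog_lin a @ -oo --> 0.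
Proof.
have -> : polylog_lin a = (fun x => x ^+ 0 * polylog_lin a x).
  by apply/funext => x; rewrite expr0 mul1r.
exact: polylog_lin_decay.
Qed.

(** Linear combinations may change sign, so nonnegativity enters for basis elements only and
    linearity does the rest. *)
Lemma polylog_lin_integrable a x : x < 0 ->
  mu.-integrable `]-oo, x] (EFin \o polylog_lin a).
Proof.
move=> x0; elim/malg_ind: a => [|q a b IHa IHb|[k s]].
- by rewrite polylog_lin0; exact: integrable0.
- rewrite polylog_linDZ.
  have -> : EFin \o (fun y => ratr q * polylog_lin a y + polylog_lin b y) =
    (fun y => (ratr q)%:E * (EFin \o polylog_lin a) y)%E \+ (EFin \o polylog_lin b) by [].
  apply: integrableD => //.
  exact: integrableZl.
- rewrite polylog_lin_bas.
  apply: (integrable_Ny_derive x0 (F := @polylog R (k.+1, s))) => [t|t|t|].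
  + exact: polylog_ge0.
  + exact: polylog_continuous.
  + exact: polylog_is_derive.
  + exact: cvg_polylog0.
Qed.

Lemma Rintegral_polylog_lin a x : x < 0 ->
  \int[mu]_(t in `]-oo, x]) polylog_lin a t = polylog_lin (Iop a) x.
Proof.
move=> x0; elim/malg_ind: a => [|q a b IHa IHb|[k s]].
- by rewrite /Iop linear0 !polylog_lin0 Rintegral_cst// mul0r.
- rewrite /Iop linext_is_linear -/Iop !polylog_linDZ -IHa -IHb.
  have ia := polylog_lin_integrable a x0; have ib := polylog_lin_integrable b x0.
  have iqa : mu.-integrable `]-oo, x] (EFin \o (fun y => ratr q * polylog_lin a y)).
    have -> : EFin \o (fun y => ratr q * polylog_lin a y) =
      (fun y => (ratr q)%:E * (EFin \o polylog_lin a) y)%E by [].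
    exact: integrableZl.
  by rewrite RintegralD// RintegralZl.
- rewrite /Iop linext_bas !polylog_lin_bas /Rintegral.
  by rewrite (integral_Ny_derive (f := @polylog R (k, s)) x0
    (fun u => @polylog_ge0 R (k, s) u) (fun u => @polylog_continuous R (k, s) u)
    (fun u => @polylog_is_derive R k s u) (cvg_polylog0 (k.+1, s))).
Qed.

Variable sh : Hge0 -> Hge0 -> Hge0.
Hypothesis shP : is_shuffle_extension sh.

Let sh0l b : sh 0 b = 0.
Proof. by have := sh_linl shP b (-1) 0 0; rewrite scaler0 addr0 scaleN1r addNr. Qed.
Let sh0r a : sh a 0 = 0.
Proof. by rewrite (sh_comm shP) sh0l. Qed.

Lemma polylog_lin_sh0 a x : x < 0 ->
  polylog_lin (sh (bas ((0%N, [::]) : symb)) a) x =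
  @polylog R (0%N, [::]) x * polylog_lin a x.
Proof.
move=> x0; elim/malg_ind: a => [|q a b IHa IHb|[k s]].
- by rewrite sh0r polylog_lin0 mulr0.
- by rewrite (sh_linr shP) !polylog_linDZ IHa IHb mulrDr mulrCA.
- by rewrite (sh_zero shP) !polylog_lin_bas polylog_cons.
Qed.

Lemma polylog_lin_sh_bas s t x : x < 0 ->
  polylog_lin (sh (bas s) (bas t)) x = @polylog R s x * @polylog R t x.
Proof.
(* Sum of the entries plus size of the tail: prepending 0 and raising the first entry each increase
   this weight by exactly one. *)
pose m (s : symb) := (sumn (seq_of_symb s) + size s.2)%N.
have [n] := ubnP (m s + m t)%N.
elim: n s t x => // n IH s t x lt x0.
(* If a factor starts with 0, it is the product of [0] with a lighter symbol, and associativity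
   moves [0] to the front. *)
have Ez u v y : (m u + m v < n)%N -> y < 0 ->
    polylog_lin (sh (bas ((0%N, seq_of_symb u) : symb)) (bas v)) y =
    @polylog R (0%N, seq_of_symb u) y * @polylog R v y.
  move=> le y0; rewrite -(sh_zero shP) -(sh_assoc shP) polylog_lin_sh0// IH//.
  by case: u {le} => k u; rewrite polylog_cons// mulrA.
case: s lt => -[|i] s; first case: s => [|j s] lt.
- by rewrite polylog_lin_sh0// polylog_lin_bas.
- by apply: (Ez (j, s)) => //; move: lt; rewrite /m /=; lia.
case: t => -[|k] t; first case: t => [|j t] lt.
- by rewrite (sh_comm shP) polylog_lin_sh0// polylog_lin_bas mulrC.
- rewrite (sh_comm shP) mulrC.
  by apply: (Ez (j, t)) => //; move: lt; rewrite /m /=; lia.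
move=> lt; pose a : Hge0 := bas ((i, s) : symb); pose b : Hge0 := bas ((k, t) : symb).
have Ia : Iop a = bas ((i.+1, s) : symb) by rewrite /Iop linext_bas.
have Ib : Iop b = bas ((k.+1, t) : symb) by rewrite /Iop linext_bas.
(* Both first entries are positive, so both factors lie in the image of I. The Rota-Baxter identity
   differentiates to the Leibniz rule, and the induction hypothesis cancels H'. *)
pose H y := polylog_lin (sh (Iop a) (Iop b)) y +
  (-1) * (@polylog R (i.+1, s) y * @polylog R (k.+1, t) y).
have shE : forall y, y < 0 -> H y = 0.
  apply: eq0_of_derive0 => [z z0|]; rewrite /H (sh_RB shP) polylog_linD.
    apply: is_derive_eq (derive_add (derive_add
      (polylog_lin_Iop_is_derive _ z0) (polylog_lin_Iop_is_derive _ z0))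
      (derive_scale (-1) (derive_mul (polylog_is_derive _ _ z0) (polylog_is_derive _ _ z0)))) _.
    by rewrite Ia Ib !IH ?mulN1r ?subrr//; move: lt; rewrite /m /=; lia.
  have prod0 : (fun y => -1 * (@polylog R (i.+1, s) y * @polylog R (k.+1, t) y)) @ -oo --> 0.
    rewrite -[X in _ --> X](mulr0 (-1)); apply: cvgMr.
    by rewrite -[X in _ --> X](mulr0 0); apply: cvgM; exact: cvg_polylog0.
  rewrite -[X in _ --> X](addr0 0); apply: cvgD prod0.
  by rewrite -[X in _ --> X](addr0 0); apply: cvgD; exact: cvg_polylog_lin0.
by rewrite -Ia -Ib; apply/eqP; rewrite -subr_eq0 -mulN1r -[_ + _]/(H x) shE.
Qed.

Lemma polylog_lin_sh a b x : x < 0 ->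
  polylog_lin (sh a b) x = polylog_lin a x * polylog_lin b x.
Proof.
move=> x0; elim/malg_ind: a => [|q a a' IHa IHa'|s].
- by rewrite sh0l polylog_lin0 mul0r.
- by rewrite (sh_linl shP) !polylog_linDZ IHa IHa' mulrDl mulrA.
elim/malg_ind: b => [|q b b' IHb IHb'|t].
- by rewrite sh0r polylog_lin0 mulr0.
- by rewrite (sh_linr shP) !polylog_linDZ IHb IHb' mulrDr mulrCA.
by rewrite polylog_lin_sh_bas// !polylog_lin_bas.
Qed.

End RealLinearExtension.

(** * Complex-valued functions *)

Section ComplexLimits.
Variable R : realType.
Implicit Types (x y l : R) (z : R[i]).

Lemma norm_real_complex x : `|x%:C| = `|x|%:C.
Proof. by rewrite normc_def/= expr0n addr0 sqrtr_sqr. Qed.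

Lemma cvg_real_complex (T : Type) (F : set_system T) {FF : Filter F} (u : T -> R) l :
  u @ F --> l -> (fun t => (u t)%:C : R[i]^o) @ F --> (l%:C : R[i]^o).
Proof.
move=> ul; apply/cvgrPdist_lt => e e0.
(* A positive element of R[i] is real, so the complex epsilon is replaced by its real part. *)
have eE : (complex.Re e)%:C = e by apply: RRe_real; rewrite realE (ltW e0).
have e0' : 0 < complex.Re e by rewrite -ltcR eE.
move/cvgrPdist_lt : ul => /(_ _ e0'); apply: filterS => t ut.
by rewrite -rmorphB/= norm_real_complex -eE ltcR.
Qed.

Lemma normc_le_ReIm z : `|z| <= (`|complex.Re z| + `|complex.Im z|)%:C.
Proof.
rewrite [z in leLHS]complexE; apply: le_trans (ler_normD _ _) _.
have -> : `|'i%C * (complex.Im z)%:C| = `|(complex.Im z)%:C|.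
  rewrite normrM (_ : `|'i%C : R[i]| = 1) ?mul1r//.
  by rewrite normc_def/= expr0n expr1n add0r sqrtr1.
by rewrite !norm_real_complex rmorphD.
Qed.

Lemma cvg_complex (u : nat -> R[i]) a b :
  (fun n => complex.Re (u n)) @ \oo --> a -> (fun n => complex.Im (u n)) @ \oo --> b ->
  (u : nat -> R[i]^o) @ \oo --> (a +i* b : R[i]^o).
Proof.
move=> /cvgrPdist_lt ua /cvgrPdist_lt ub; apply/cvgrPdist_lt => e e0.
have eE : (complex.Re e)%:C = e by exact: (RRe_real (gtr0_real e0)).
have e2 : 0 < complex.Re e / 2 by rewrite divr_gt0// -ltcR eE.
move: (ua _ e2) (ub _ e2); apply: filterS2 => n uan ubn.
apply: le_lt_trans (normc_le_ReIm _) _.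
rewrite -eE ltcR [ltRHS]splitr; apply: ltrD.
  by move: uan; case: (u n).
by move: ubn; case: (u n).
Qed.

Lemma normc_ge_Im z : `|complex.Im z|%:C <= `|z|.
Proof.
rewrite normc_def lecR -sqrtr_sqr ler_wsqrtr//.
by rewrite lerDr sqr_ge0.
Qed.

(** Real and imaginary parts are each dominated by the convergent real series of |a_n| * |z|^n. *)
Lemma cvg_complex_pseries (a : nat -> R) r z : rad a r -> `|z| < r%:C ->
  cvgn (series (fun n => (a n)%:C * z ^+ n) : nat -> R[i]^o).
Proof.
move=> ar zr; pose rho := complex.Re `|z|.
have zE : `|z| = rho%:C by rewrite /rho RRe_real ?normr_real.
have rho0 : 0 <= rho by rewrite -lecR -zE normr_ge0.
have rhor : `|rho| < r by rewrite ger0_norm// -ltcR -zE.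
have ab : cvgn (pseries (fun n => `|a n|) rho).
  apply: rad_cvg rhor; apply: (@rad_dominated _ 1 a) => // n.
  by rewrite normr_id mul1r.
have bound (p : R[i] -> R) : (forall w, `|p w|%:C <= `|w|) ->
    cvgn (series (fun n => a n * p (z ^+ n))).
  move=> pw; apply: normed_cvg; rewrite /normed_series_of/=.
  apply: (series_le_cvg _ _ _ ab) => [n|n|n] //.
  - by rewrite mulr_ge0// exprn_ge0.
  - rewrite normrM ler_wpM2l// -lecR (le_trans (pw _))//.
    by rewrite normrX zE rmorphXn.
have /cvg_ex[/= la laE] := bound (@complex.Re R) (@normc_ge_Re R).
have /cvg_ex[/= lb lbE] := bound (@complex.Im R) normc_ge_Im.
apply/cvg_ex; exists (la +i* lb : R[i]^o).
have ReD : {morph @complex.Re R : x y / x + y} by case=> ? ? [].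
have ImD : {morph @complex.Im R : x y / x + y} by case=> ? ? [].
apply: cvg_complex.
- rewrite (_ : (fun n => _) = series (fun n => a n * complex.Re (z ^+ n)))//.
  apply/funext => n; rewrite /series/= (big_morph _ ReD (erefl _)).
  by apply: eq_bigr => i _; case: (z ^+ i) => u v; rewrite /= mul0r subr0.
- rewrite (_ : (fun n => _) = series (fun n => a n * complex.Im (z ^+ n)))//.
  apply/funext => n; rewrite /series/= (big_morph _ ImD (erefl _)).
  by apply: eq_bigr => i _; case: (z ^+ i) => u v; rewrite /= mul0r addr0.
Qed.

Lemma cvg_scale_complex (k l : R[i]) (u : nat -> R[i]^o) :
  u @ \oo --> (l : R[i]^o) -> (fun n => k * u n : R[i]^o) @ \oo --> (k * l : R[i]^o).
Proof. exact: (@cvgZl_tmp R[i] R[i]^o _ _ _ k). Qed.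

Lemma limn_complex (u : nat -> R[i]^o) (l : R[i]) :
  u @ \oo --> (l : R[i]^o) -> limn u = l.
Proof. by move=> ul; exact: (@cvg_lim _ (@norm_hausdorff _ R[i]^o) _ _ _ _ _ ul). Qed.

Lemma laurent_partialE p (a : nat -> R[i]) z n : z != 0 ->
  laurent_partial p a z n = (z ^+ p)^-1 * (\sum_(0 <= i < n) a i * z ^+ i).
Proof.
move=> z0; rewrite /laurent_partial /series/= mulr_sumr; apply: eq_bigr => i _.
by rewrite expfzDr// -exprnP exprnN mulrA [RHS]mulrC.
Qed.

Lemma laurent_converges_real (a : nat -> R) r p : rad a r ->
  laurent_converges r p (fun n => (a n)%:C).
Proof.
move=> ar z /andP[z0 zr]; rewrite normr_gt0 in z0.
have /cvg_ex[/= l ul] := cvg_complex_pseries ar zr.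
apply/cvg_ex; exists ((z ^+ p)^-1 * l : R[i]^o).
have := cvg_scale_complex (k := (z ^+ p)^-1) ul.
rewrite (_ : laurent_partial _ _ _ = (fun n => (z ^+ p)^-1 *
  series (fun n => (a n)%:C * z ^+ n) n))//.
by apply/funext => n; rewrite laurent_partialE.
Qed.

Lemma real_pseries (a : nat -> R) x n :
  \sum_(0 <= i < n) (a i)%:C * x%:C ^+ i = (pseries a x n)%:C.
Proof.
rewrite /pseries /series/= rmorph_sum/=; apply: eq_bigr => i _.
by rewrite rmorphM rmorphXn.
Qed.

Lemma laurent_sum_real (a : nat -> R) r p x : rad a r -> x != 0 -> `|x| < r ->
  laurent_sum p (fun n => (a n)%:C) x%:C = ((x ^+ p)^-1 * PS a x)%:C.
Proof.
move=> ar x0 xr; apply: limn_complex.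
rewrite rmorphM fmorphV rmorphXn /=.
have ux : (fun n => (pseries a x n)%:C : R[i]^o) @ \oo --> ((PS a x)%:C : R[i]^o).
  by apply: cvg_real_complex; exact: rad_PS_cvg xr.
have := cvg_scale_complex (k := (x%:C ^+ p)^-1) ux.
rewrite (_ : laurent_partial _ _ _ = (fun n => (x%:C ^+ p)^-1 * (pseries a x n)%:C))//.
apply/funext => n; rewrite laurent_partialE ?real_pseries//.
by rewrite -[0]/(0%:C) (inj_eq (@complexI R)).
Qed.

(** Each clause of [CLogS] looks only at negative arguments, where f is the real function g; the
    single pole order of g serves all powers of the logarithm. *)
Lemma CLogS_real (g : R -> R) (f : R -> R[i]) :
  (forall x, x < 0 -> f x = (g x)%:C) ->
  (forall x, x < 0 -> {for x, continuous g}) ->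
  log_laurent_near0 g ->
  (forall n, (fun x => x ^+ n * g x) @ -oo --> 0) ->
  CLogS f.
Proof.
move=> fg cg [r [p [d [A [r0 Ar gE]]]]] g0; split.
- apply: continuous_in_subspaceT => x; rewrite inE/= in_itv/= => x0.
  rewrite /continuous_at fg//.
  apply: cvg_trans (cvg_real_complex (cg x x0)).
  apply: near_eq_cvg; near=> y; rewrite fg//.
  near: y; exact: lt_nbhsl.
- exists r, d, (fun=> p), (fun j n => (A j n)%:C); split => //.
    by move=> j _; exact: laurent_converges_real.
  move=> x xr; have x0 : x < 0 by case/andP: xr.
  rewrite fg// gE// /log_laurent mulr_sumr rmorph_sum/=; apply: eq_bigr => j _.
  rewrite (laurent_sum_real p (Ar j)) ?(ltr_norm_near0 xr) ?lt_eqF//.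
  by rewrite -rmorphXn -rmorphM mulrA.
- move=> n; apply: cvg_trans (cvg_real_complex (g0 n)).
  apply: near_eq_cvg; near=> x; rewrite fg; last first.
    by near: x; apply: nbhs_ninfty_lt; exact: num_real.
  by rewrite rmorphM rmorphXn.
Unshelve. all: by end_near.
Qed.

Lemma Jop_real (g : R -> R) (f : R -> R[i]) x : x < 0 ->
  (forall t : R, t < 0 -> f t = (g t)%:C) ->
  Jop f x = (\int[lebesgue_measure]_(t in `]-oo, x]) g t)%:C.
Proof.
move=> x0 fg; rewrite /Jop; apply/eqP; rewrite eq_complex /=; apply/andP; split; apply/eqP.
  apply: eq_Rintegral => t; rewrite inE/= in_itv/= => tx.
  by rewrite fg//; exact: le_lt_trans tx x0.
rewrite (@eq_Rintegral _ _ _ _ _ (fun=> 0)); first by rewrite Rintegral_cst// mul0r.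
move=> t; rewrite inE/= in_itv/= => tx.
by rewrite fg//; exact: le_lt_trans tx x0.
Qed.

End ComplexLimits.

(** * Sums over decreasing tuples as nested sums *)

Section LiSeries.
Variable R : realType.

(** Splits off the first index of the tuple, so that multiple sums are computed by recursion on the
    depth. *)
Lemma sum_cons_tuple (T : finType) (V : nmodType) k (P : pred (k.+1.-tuple T))
    (F : k.+1.-tuple T -> V) :
  \sum_(t | P t) F t =
  \sum_(i : T) \sum_(t : k.-tuple T | P [tuple of i :: t]) F [tuple of i :: t].
Proof.
rewrite (reindex (fun p : T * k.-tuple T => [tuple of p.1 :: p.2])).
  by rewrite pair_big_dep.
exists (fun t : k.+1.-tuple T => (thead t, [tuple of behead t])) => [[i t] _|t _].
  by rewrite theadE; congr (_, _); apply: val_inj.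
by rewrite /=; apply/esym; rewrite [LHS]tuple_eta.
Qed.

Lemma prod_cons_tuple k N (i : 'I_N) (t : k.-tuple 'I_N) (c : int) (cs : seq int) :
  \prod_(j < k.+1) ((tnth [tuple of i :: t] j)%:R : R[i]) ^ (c :: cs)`_j =
  i%:R ^ c * \prod_(j < k) ((tnth t j)%:R : R[i]) ^ cs`_j.
Proof.
by rewrite big_ord_recl tnth0; congr (_ * _); apply: eq_bigr => j _; rewrite tnthS.
Qed.

(** The condition left on the tail once the head m of a decreasing tuple has been split off. *)
Definition admissible (m : nat) (l : seq nat) : bool := path gtn m l && all (leq 1) l.

(** The entries range below N, but m <= N makes m the effective bound; this generality lets the
    induction descend to m = i. *)
Lemma sum_decreasing_tuples (s : seq nat) N m : (m <= N)%N ->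
  \sum_(t : (size [seq n%:Z | n <- s]).-tuple 'I_N | admissible m [seq val i | i <- t])
    (\prod_(j < size [seq n%:Z | n <- s])
       ((tnth t j)%:R : R[i]) ^ [seq n%:Z | n <- s]`_j)^-1
  = (nested_sum R s m)%:C.
Proof.
elim: s m => [|k s IHs] m mN.
  rewrite (big_pred1 [tuple]) ?big_ord0 ?invr1// => t.
  by rewrite tuple0 /= eqxx.
rewrite sum_cons_tuple.
transitivity (\sum_(i < N | (1 <= i < m)%N)
    ((i%:R ^+ k)^-1 * nested_sum R s i)%:C); last first.
  rewrite /= rmorph_sum/= (big_nat_widenl 1 0)// (big_nat_widen 0 m N)// big_mkord.
  by apply: eq_bigl => i.
rewrite [RHS]big_mkcond; apply: eq_bigr => i _.
case: ifP => [/andP[i1 im]|/negbT im].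
  rewrite rmorphM fmorphV rmorphXn rmorph_nat /= -(IHs i (ltnW (ltn_ord i))) mulr_sumr.
  apply: eq_big => [t|t _].
    by rewrite /admissible /= im i1.
  by rewrite prod_cons_tuple invfM.
rewrite big_pred0// => t; apply/negbTE; apply: contra im.
by rewrite /admissible /= => /andP[/andP[-> _] /andP[-> _]].
Qed.

Lemma Li_partial_real k s (z : R) N :
  Li_partial [seq n%:Z | n <- k :: s] z%:C N = (pseries (polylog_coef R (k, s)) z N)%:C.
Proof.
rewrite /Li_partial sum_cons_tuple -real_pseries big_mkord.
apply: eq_bigr => i _; rewrite /polylog_coef.
(* A leading index 0 is excluded from the sum over tuples, in agreement with the zero coefficient of
   z^0. *)
case: (posnP i) => [i0|i1].
  rewrite mul0r big_pred0// => t; apply/negbTE.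
  by rewrite /= i0 andbF.
rewrite rmorphM fmorphV rmorphXn rmorph_nat /=.
rewrite -(sum_decreasing_tuples s (ltnW (ltn_ord i))) mulr_sumr mulr_suml.
apply: eq_big => [t|t _].
  by rewrite /admissible /= i1.
by rewrite prod_cons_tuple invfM -exprnP mulrC.
Qed.

Lemma Li_exp_real k s (x : R) : x < 0 ->
  @Li_exp R (k :: s) x = (@polylog R (k, s) x)%:C.
Proof.
move=> x0; apply: limn_complex.
rewrite (_ : Li_partial _ _ = (fun N => (pseries (polylog_coef R (k, s)) (expR x) N)%:C)).
  apply: cvg_real_complex.
  exact: rad_PS_cvg (@rad_polylog R (k, s)) (norm_expR_lt1 x0).
by apply/funext => N; exact: Li_partial_real.
Qed.

Lemma frakL_real a (x : R) : x < 0 -> @frakL R a x = (@polylog_lin R a x)%:C.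
Proof.
move=> x0; rewrite /frakL /polylog_lin rmorph_sum; apply: eq_bigr => -[k s] _.
by rewrite Li_exp_real// rmorphM/= fmorph_rat.
Qed.

End LiSeries.

Theorem theorem4p6 (R : realType) :
  (forall s : seq nat, s != [::] -> CLogS (@Li_exp R s)) /\
  (forall sh : Hge0 -> Hge0 -> Hge0, is_shuffle_extension sh ->
     RB_hom sh (@frakL R) /\
     (forall phi : Hge0 -> R -> R[i], RB_hom sh phi ->
        (forall x : R, x < 0 ->
           phi (bas ((0%N, [::]) : symb)) x = (expR x / (1 - expR x))%:C) ->
        forall (s : symb) (x : R), x < 0 ->
          Li_exp (seq_of_symb s) x = phi (bas s) x)).
Proof.
split=> [[//|k s] _|sh shP].
  apply: (@CLogS_real _ (@polylog R (k, s))).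
  - exact: Li_exp_real.
  - exact: polylog_continuous.
  - exact: polylog_near0.
  - by move=> n; exact: polylog_decay.
split.
  split=> [a|q a b x x0|a b x x0|a x x0].
  - apply: (@CLogS_real _ (@polylog_lin R a)).
    + exact: frakL_real.
    + exact: polylog_lin_continuous.
    + exact: polylog_lin_near0.
    + by move=> n; exact: polylog_lin_decay.
  - by rewrite !frakL_real// polylog_linDZ rmorphD rmorphM/= fmorph_rat.
  - by rewrite !frakL_real// (polylog_lin_sh shP)// rmorphM.
  - rewrite frakL_real// -Rintegral_polylog_lin//.
    by rewrite (Jop_real x0 (fun t => @frakL_real R a t)).
move=> phi [_ _ phiM phiJ] phi0.
(* The value on [0], multiplicativity with [0] and compatibility with I and J give [phi] the two
   recursions of the polylogarithms, so induction along [symb_ind] identifies them. *)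
suff phiE s : forall x, x < 0 -> phi (bas s) x = (@polylog R s x)%:C.
  by move=> [k s] x x0; rewrite phiE// Li_exp_real.
elim/symb_ind: s => [|k s IH|k s IH] x x0.
- by rewrite phi0// polylog_nil.
- rewrite polylog_cons// rmorphM/= -IH// polylog_nil// -phi0// -phiM//.
  by rewrite (sh_zero shP).
- have <- : Iop (bas ((k, s) : symb)) = bas ((k.+1, s) : symb).
    by rewrite /Iop linext_bas.
  (* By the induction hypothesis J integrates the real polylogarithm of (k, s), whose integral from
     -oo is that of (k + 1, s). *)
  rewrite phiJ// (Jop_real x0 IH) -polylog_lin_bas Rintegral_polylog_lin//.
  by rewrite /Iop linext_bas polylog_lin_bas.
Qed.
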